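(* Let $(\Omega, \mathcal{A}, \mu)$ be a finite measure space and let $\mathcal{M}$ be a subspace of $\mathcal{L}(L_1(\mu))$ such that $\mathcal{F}(L_1(\mu)) \subseteq \mathcal{M} \subseteq \mathcal{R}(L_1(\mu))$. Assume also that for each measurable subset $A$ of $\Omega$ and each $T \in \mathcal{M}$ it holds that $T_{\vert A} \in \mathcal{M}$. Then $\mathcal{M}$ has the BPBp-$\nu$, and the function $\eta$ appearing in the definition of the BPBp-$\nu$ can be taken independent of the measure space and of $\mathcal{M}$. That is, there is a function $\eta : (0,1) \to (0,\infty)$ such that, for every finite measure space $(\Omega,\mathcal{A},\mu)$, every subspace $\mathcal{M}$ of $\mathcal{L}(L_1(\mu))$ satisfying $\mathcal{F}(L_1(\mu)) \subseteq \mathcal{M} \subseteq \mathcal{R}(L_1(\mu))$ and $T_{\vert A} \in \mathcal{M}$ for each $T \in \mathcal{M}$ and each measurable subset $A$ of $\Omega$ has the BPBp-$\nu$ with this function $\eta$.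
   Context: All normed spaces are over the field of scalars $\mathbb{K}$, which may be either $\mathbb{R}$ or $\mathbb{C}$ (the result is asserted in both cases). For a Banach space $X$, $S_X$ is its unit sphere, $X^*$ its topological dual, $\mathcal{L}(X)$ the space of bounded linear operators on $X$ with the operator norm, and $\mathcal{F}(X)$ the space of finite-rank bounded operators on $X$. Subspaces are linear subspaces (not assumed closed). Numerical radius: for $T \in \mathcal{L}(X)$, $\nu(T) = \sup\{ |x^*(T(x))| : x \in S_X,\ x^* \in S_{X^*},\ x^*(x) = 1\}$. BPBp-$\nu$: a subspace $\mathcal{M}$ of $\mathcal{L}(X)$ has the Bishop-Phelps-Bollobás property for numerical radius (BPBp-$\nu$) if for every $0<\varepsilon<1$ there is $\eta(\varepsilon)>0$ such that whenever $S \in \mathcal{M}$ with $\nu(S)=1$, $x_0 \in S_X$ and $x_0^* \in S_{X^*}$ satisfy $x_0^*(x_0)=1$ and $|x_0^*(S(x_0))| > 1-\eta(\varepsilon)$, there are $T \in \mathcal{M}$, $x_1 \in S_X$ and $x_1^* \in S_{X^*}$ such that (i) $x_1^*(x_1)=1$; (ii) $|x_1^*(T(x_1))| = \nu(T) = 1$; (iii) $\nu(T-S)<\varepsilon$, $\|x_1-x_0\|<\varepsilon$ and $\|x_1^*-x_0^*\|<\varepsilon$. Representable operators: for a finite measure space $(\Omega,\mathcal{A},\mu)$ and a Banach space $Y$, an operator $T \in \mathcal{L}(L_1(\mu),Y)$ is (Riesz) representable if there is $h \in L_\infty(\mu,Y)$ (the space of essentially bounded strongly measurable $Y$-valued functions)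 such that $T(f)=\int_\Omega h f \, d\mu$ (Bochner integral) for all $f \in L_1(\mu)$. $\mathcal{R}(L_1(\mu))$ denotes the space of representable operators from $L_1(\mu)$ into $L_1(\mu)$. For $T \in \mathcal{L}(L_1(\mu))$ and a measurable set $A \subseteq \Omega$, $T_{\vert A}$ is the operator on $L_1(\mu)$ given by $T_{\vert A}(f) = T(f\chi_A)$ for all $f \in L_1(\mu)$, where $\chi_A$ is the characteristic function of $A$. *)

(* Defs.v *)
From HB Require Import structures.
From mathcomp Require Import all_boot all_order all_algebra.
From mathcomp Require Import generic_quotient ring_quotient complex.
From mathcomp Require Import all_classical all_reals all_analysis.
From mathcomp Require Import measurable_realfun.

Set Implicit Arguments.
Unset Strict Implicit.
Unset Printing Implicit Defensive.
Import Order.TTheory GRing.Theory Num.Theory.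
Import numFieldNormedType.Exports.

Local Open Scope classical_set_scope.
Local Open Scope ring_scope.

Variant scalars := RealScalars | ComplexScalars.

Definition scalar_field (R : realType) (s : scalars) : numFieldType :=
  match s with RealScalars => R | ComplexScalars => R[i] end.

Section ScalarField.
Context {R : realType} {s : scalars}.
Local Notation K := (scalar_field R s).

Definition repart : K -> R :=
  match s return scalar_field R s -> R with
  | RealScalars => fun x => x
  | ComplexScalars => fun z => complex.Re z
  end.

Definition impart : K -> R :=
  match s return scalar_field R s -> R with
  | RealScalars => fun=> 0
  | ComplexScalars => fun z => complex.Im z
  end.

Definition of_real : R -> K :=
  match s return R -> scalar_field R s with
  | RealScalars => fun x => x
  | ComplexScalars => fun x => (x%:C)%C
  end.

(* The norm of a normed module over K takes its values in K, even when K is  *)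
(* the field of complex numbers; rnorm is the same norm with values in R.    *)
Definition rnorm (V : normedModType K) (x : V) : R := repart `|x|.

Lemma repartD : {morph repart : x y / x + y}.
Proof. by rewrite /repart; case: s => // -[a b] [c d]. Qed.

Lemma impartD : {morph impart : x y / x + y}.
Proof. by rewrite /impart; case: s => [x y|[a b] [c d]]//=; rewrite addr0. Qed.

Lemma repartM x y : repart (x * y) = repart x * repart y - impart x * impart y.
Proof.
rewrite /repart /impart; case: s x y => [x y|[a b] [c d]]//=.
by rewrite mulr0 subr0.
Qed.

Lemma impartM x y : impart (x * y) = repart x * impart y + impart x * repart y.
Proof.
rewrite /repart /impart; case: s x y => [x y|[a b] [c d]]//=.
by rewrite mulr0 mul0r addr0.
Qed.

Lemma repart0 : repart 0 = 0. Proof. by rewrite /repart; case: s. Qed.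
Lemma impart0 : impart 0 = 0. Proof. by rewrite /impart; case: s. Qed.

Lemma of_realK : cancel of_real repart.
Proof. by rewrite /repart /of_real; case: s. Qed.

Lemma of_realD : {morph of_real : x y / x + y}.
Proof.
rewrite /of_real; case: s => // x y.
by apply/eqP; rewrite eq_complex /= addr0 !eqxx.
Qed.

Lemma of_realM : {morph of_real : x y / x * y}.
Proof.
rewrite /of_real; case: s => // x y.
by apply/eqP; rewrite eq_complex /= !mulr0 mul0r subr0 addr0 !eqxx.
Qed.

Lemma le_of_real x y : x <= y -> of_real x <= of_real y.
Proof. by rewrite /of_real; case: s => //; rewrite lecR. Qed.

Lemma of_real0 : of_real 0 = 0. Proof. by rewrite /of_real; case: s. Qed.

Lemma repart_normK (x : K) : of_real (repart `|x|) = `|x|.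
Proof. by move: x; rewrite /repart /of_real; case: s. Qed.

Lemma repart_normE (x : K) :
  repart `|x| = Num.sqrt (repart x ^+ 2 + impart x ^+ 2).
Proof.
move: x; rewrite /repart /impart; case: s => [x|[a b]]//.
by rewrite expr0n addr0 sqrtr_sqr.
Qed.

Lemma le_repart (x y : K) : x <= y -> repart x <= repart y.
Proof. by move: x y; rewrite /repart; case: s => // -[a b] [c d] /andP[]. Qed.

Lemma repartK (x : K) : 0 <= x -> of_real (repart x) = x.
Proof. by move=> x0; rewrite -(ger0_norm x0) repart_normK. Qed.

Lemma repartZ (r : R) (x : K) : repart (of_real r * x) = r * repart x.
Proof.
move: x; rewrite /repart /of_real; case: s => // -[a b] /=.
by rewrite mul0r subr0.
Qed.

Lemma impartZ (r : R) (x : K) : impart (of_real r * x) = r * impart x.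
Proof.
move: x; rewrite /impart /of_real; case: s => [x|[a b]] /=.
  by rewrite mulr0.
by rewrite mul0r addr0.
Qed.

Lemma rnorm_ge0 (V : normedModType K) (x : V) : 0 <= rnorm x.
Proof. by rewrite -repart0; exact/le_repart. Qed.

Lemma rnormD (V : normedModType K) (x y : V) :
  rnorm (x + y) <= rnorm x + rnorm y.
Proof. by rewrite /rnorm -repartD; exact/le_repart/ler_normD. Qed.

Lemma rnormZ (V : normedModType K) (a : K) (x : V) :
  rnorm (a *: x) = rnorm a * rnorm x.
Proof. by rewrite /rnorm normrZ -{1}(repart_normK a) repartZ. Qed.

Lemma rnorm_eq0 (V : normedModType K) (x : V) : rnorm x = 0 -> x = 0.
Proof.
move=> x0; apply: normr0_eq0.
by rewrite -(@repartK `|x|)// -/(rnorm x) x0 of_real0.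
Qed.

End ScalarField.

Section Operators.
Context (R : realType) (s : scalars).
Local Notation K := (scalar_field R s).

Definition bounded_operator (X Y : normedModType K) (T : X -> Y) : Prop :=
  linear T /\ exists C : R, forall x, rnorm (T x) <= C * rnorm x.

Definition opnorm (X Y : normedModType K) (T : X -> Y) : R :=
  sup [set rnorm (T x) | x in [set x : X | rnorm x <= 1]].

Definition finite_rank (X Y : normedModType K) (T : X -> Y) : Prop :=
  bounded_operator T /\
  exists n (e : 'I_n -> Y), forall x, exists c : 'I_n -> K,
    T x = \sum_(i < n) c i *: e i.

Definition linear_subspace (X Y : normedModType K) (M : set (X -> Y)) : Prop :=
  M (fun=> 0) /\
  forall (a : K) S T, M S -> M T -> M (fun x => a *: S x + T x).

Variable X : normedModType K.

Definition sphere : set X := [set x | rnorm x = 1].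

Definition dual_sphere : set (X -> K) :=
  [set f | @bounded_operator X K f /\ @opnorm X K f = 1].

(* sup is total on sets of reals: the set below is bounded when T is a       *)
(* bounded operator, and it is empty, with sup equal to 0, when X = {0}.     *)
Definition numerical_radius (T : X -> X) : R :=
  sup [set r | exists x f,
    [/\ sphere x, dual_sphere f, f x = 1 & r = rnorm (f (T x))]].

Definition BPBp_nu_with (M : set (X -> X)) (eta : R -> R) : Prop :=
  forall eps : R, 0 < eps < 1 ->
  forall (S : X -> X) (x0 : X) (f0 : X -> K),
    M S -> numerical_radius S = 1 -> sphere x0 -> dual_sphere f0 ->
    f0 x0 = 1 -> rnorm (f0 (S x0)) > 1 - eta eps ->
  exists (T : X -> X) (x1 : X) (f1 : X -> K),
    [/\ M T, sphere x1 & dual_sphere f1] /\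
    [/\ f1 x1 = 1,
        rnorm (f1 (T x1)) = 1,
        numerical_radius T = 1 &
        [/\ numerical_radius (fun x => T x - S x) < eps,
            rnorm (x1 - x0) < eps &
            @opnorm X K (fun x => f1 x - f0 x) < eps]].

End Operators.

Section L1.
Context (R : realType) (s : scalars).
Local Notation K := (scalar_field R s).
Context d (Omega : measurableType d) (mu : {measure set Omega -> \bar R}).
Implicit Types f g : Omega -> K.

Definition Kmeasurable f : Prop :=
  measurable_fun setT (repart \o f) /\ measurable_fun setT (impart \o f).

Definition L1integral f : \bar R := (\int[mu]_x (rnorm (f x))%:E)%E.

Definition Kintegrable : {pred Omega -> K} :=
  fun f => `[< Kmeasurable f /\ (L1integral f < +oo)%E >].

Lemma Kmeasurable_norm f : Kmeasurable f ->
  measurable_fun setT (fun x => rnorm (f x)).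
Proof.
move=> [mr mi]; rewrite (_ : (fun x => _) = (Num.sqrt : R -> R) \o
    (fun x => (repart (f x)) ^+ 2 + (impart (f x)) ^+ 2)); last first.
  by apply/funext => x; rewrite /= -repart_normE.
apply: measurableT_comp.
  by apply: continuous_measurable_fun; exact: sqrt_continuous.
by apply: measurable_funD; apply: measurable_funX.
Qed.

Lemma Kmeasurable_lin (a : K) f g : Kmeasurable f -> Kmeasurable g ->
  Kmeasurable (a *: f + g).
Proof.
move=> [fr fi] [gr gi]; split.
- rewrite (_ : _ \o _ = fun x => repart a * repart (f x)
     - impart a * impart (f x) + repart (g x)); last first.
    by apply/funext => x /=; rewrite repartD repartM.
  apply: measurable_funD => //; apply: measurable_funB;
  by apply: measurable_funM => //; exact: measurable_cst.
- rewrite (_ : _ \o _ = fun x => repart a * impart (f x)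
     + impart a * repart (f x) + impart (g x)); last first.
    by apply/funext => x /=; rewrite impartD impartM.
  apply: measurable_funD => //; apply: measurable_funD;
  by apply: measurable_funM => //; exact: measurable_cst.
Qed.

Lemma L1integralD f g : Kmeasurable f -> Kmeasurable g ->
  (L1integral (f + g)%R <= L1integral f + L1integral g)%E.
Proof.
move=> mf mg.
have mf' := Kmeasurable_norm mf; have mg' := Kmeasurable_norm mg.
have mfg : measurable_fun setT (fun x => rnorm ((f + g) x)).
  by apply: Kmeasurable_norm; rewrite -[f]scale1r; exact: Kmeasurable_lin.
rewrite /L1integral -ge0_integralD//=.
- apply: ge0_le_integral => //=.
  + by move=> x _; rewrite lee_fin rnorm_ge0.
  + exact/measurable_EFinP.
  + by apply: emeasurable_funD; exact/measurable_EFinP.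
  + by move=> x _; rewrite -EFinD lee_fin rnormD.
- by move=> x _; rewrite lee_fin rnorm_ge0.
- exact/measurable_EFinP.
- by move=> x _; rewrite lee_fin rnorm_ge0.
- exact/measurable_EFinP.
Qed.

Lemma L1integralZ (a : K) f : Kmeasurable f ->
  L1integral (a *: f) = ((rnorm a)%:E * L1integral f)%E.
Proof.
move=> mf; rewrite /L1integral -ge0_integralZl//=.
- by apply: eq_integral => x _; rewrite -EFinM -rnormZ.
- by apply/measurable_EFinP; exact: Kmeasurable_norm.
- by move=> x _; rewrite lee_fin rnorm_ge0.
- by rewrite lee_fin rnorm_ge0.
Qed.

Lemma L1integral0 : L1integral 0 = 0%E.
Proof.
apply: integral0_eq => x _; congr EFin.
by rewrite /rnorm normr0 repart0.
Qed.

Lemma Kmeasurable0 : Kmeasurable 0.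
Proof.
split.
- by rewrite (_ : _ \o _ = cst 0)//; apply/funext => x /=; rewrite repart0.
- by rewrite (_ : _ \o _ = cst 0)//; apply/funext => x /=; rewrite impart0.
Qed.

Lemma Kintegrable_submod_closed : submod_closed Kintegrable.
Proof.
split.
  apply/asboolP; split; first exact: Kmeasurable0.
  by rewrite L1integral0.
move=> a f g /asboolP[mf intf] /asboolP[mg intg]; apply/asboolP; split.
  exact: Kmeasurable_lin.
have maf : Kmeasurable (a *: f).
  by rewrite -[a *: f]addr0; apply: Kmeasurable_lin => //; exact: Kmeasurable0.
rewrite (le_lt_trans (L1integralD maf mg))// lte_add_pinfty//.
by rewrite L1integralZ// lte_mul_pinfty// lee_fin rnorm_ge0.
Qed.

HB.instance Definition _ :=
  GRing.isSubmodClosed.Build _ _ Kintegrable Kintegrable_submod_closed.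

Record integrable_fun := IntegrableFun {
  integrable_val :> Omega -> K;
  integrable_valP : integrable_val \in Kintegrable }.

HB.instance Definition _ := [isSub for integrable_val].
HB.instance Definition _ := [Choice of integrable_fun by <:].
HB.instance Definition _ := [SubChoice_isSubLmodule of integrable_fun by <:].

Lemma integrable_funP (f : integrable_fun) :
  Kmeasurable f /\ (L1integral f < +oo)%E.
Proof. exact/asboolP/(integrable_valP f). Qed.

(* L_1(mu) is the quotient of the space of integrable functions by the       *)
(* subspace of the functions that vanish almost everywhere.                  *)
Definition ae_zero : {pred integrable_fun} :=
  fun f : integrable_fun => `[< {ae mu, forall x, f x = 0} >].

Lemma ae_zero_submod_closed : submod_closed ae_zero.
Proof.
split; first exact/asboolP/nearW.
move=> a f g /asboolP f0 /asboolP g0; apply/asboolP.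
apply: filterS2 f0 g0 => x f0 g0.
by rewrite /= -[LHS]/(a * f x + g x) f0 g0 mulr0 addr0.
Qed.

HB.instance Definition _ :=
  GRing.isSubmodClosed.Build _ _ ae_zero ae_zero_submod_closed.

Definition L1 : Type := Quotient.quot ae_zero.

HB.instance Definition _ := GRing.Zmodule.on L1.
HB.instance Definition _ := EqQuotient.on L1.

Definition L1class (f : integrable_fun) : L1 := (\pi_L1 f)%qT.

Lemma L1classP (f g : integrable_fun) :
  L1class f = L1class g <-> {ae mu, forall x, f x = g x}.
Proof.
transitivity (f - g \in ae_zero).
  by rewrite Quotient.idealrBE; split => /eqP.
split => [/asboolP|fg].
  by apply: filterS => x /eqP; rewrite -[_ x]/(f x - g x) subr_eq0 => /eqP.
apply/asboolP; apply: filterS fg => x fg; apply/eqP.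
by rewrite -[_ x]/(f x - g x) subr_eq0 fg.
Qed.

Definition L1repr (u : L1) : integrable_fun := repr u.

Lemma L1reprK : cancel L1repr L1class.
Proof. by move=> u; exact: reprK. Qed.

Lemma L1classD : {morph L1class : f g / f + g}.
Proof. exact: Quotient.pi_add. Qed.

Lemma L1class0 : L1class 0 = 0.
Proof. by rewrite /L1class piE. Qed.

Definition L1scale (a : K) (u : L1) : L1 := L1class (a *: L1repr u).

Lemma L1classZ (a : K) (f : integrable_fun) :
  L1class (a *: f) = L1scale a (L1class f).
Proof.
apply/L1classP; have /L1classP := L1reprK (L1class f).
by apply: filterS => x /= fx; rewrite -[LHS]/(a * f x) -fx.
Qed.

Lemma L1scaleA a b u : L1scale a (L1scale b u) = L1scale (a * b) u.
Proof. by rewrite -(L1reprK u) -!L1classZ scalerA. Qed.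

Lemma L1scale1 : left_id 1 L1scale.
Proof. by move=> u; rewrite -(L1reprK u) -!L1classZ scale1r. Qed.

Lemma L1scaleDr : right_distributive L1scale +%R.
Proof.
move=> a u v.
by rewrite -(L1reprK u) -(L1reprK v) -L1classD -!L1classZ scalerDr L1classD.
Qed.

Lemma L1scaleDl u : {morph L1scale^~ u : a b / a + b}.
Proof.
by move=> a b; rewrite -(L1reprK u) -!L1classZ scalerDl L1classD.
Qed.

HB.instance Definition _ := GRing.Zmodule_isLmodule.Build K L1
  L1scaleA L1scale1 L1scaleDr L1scaleDl.

Definition L1norm (u : L1) : K := of_real (fine (L1integral (L1repr u))).

Lemma L1normE (f : integrable_fun) :
  L1norm (L1class f) = of_real (fine (L1integral f)).
Proof.
congr (of_real (fine _)); apply: ge0_ae_eq_integral => //.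
- have [mf _] := integrable_funP (L1repr (L1class f)).
  by apply/measurable_EFinP; exact: Kmeasurable_norm.
- have [mf _] := integrable_funP f.
  by apply/measurable_EFinP; exact: Kmeasurable_norm.
- by move=> x _; rewrite lee_fin rnorm_ge0.
- by move=> x _; rewrite lee_fin rnorm_ge0.
- have /L1classP := L1reprK (L1class f).
  by apply: filterS => x ->.
Qed.

Lemma L1integral_ge0 (f : Omega -> K) : (0 <= L1integral f)%E.
Proof. by apply: integral_ge0 => x _; rewrite lee_fin rnorm_ge0. Qed.

Lemma L1integral_fin_num (f : integrable_fun) : L1integral f \is a fin_num.
Proof.
by rewrite ge0_fin_numE ?L1integral_ge0//; case: (integrable_funP f).
Qed.

Lemma L1normD u v : L1norm (u + v) <= L1norm u + L1norm v.
Proof.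
rewrite -(L1reprK u) -(L1reprK v) -L1classD !L1normE -of_realD.
have [[mf _] [mg _]] := (integrable_funP (L1repr u), integrable_funP (L1repr v)).
apply: le_of_real; rewrite -fineD ?L1integral_fin_num//.
apply: fine_le; first exact: L1integral_fin_num.
  by rewrite fin_numD !L1integral_fin_num.
exact: L1integralD.
Qed.

Lemma L1normZ (a : K) u : L1norm (a *: u) = `|a| * L1norm u.
Proof.
rewrite -(L1reprK u) [a *: _](_ : _ = L1scale a (L1class (L1repr u)))//.
rewrite -L1classZ !L1normE L1integralZ; last by case: (integrable_funP (L1repr u)).
by rewrite fineM ?L1integral_fin_num// of_realM repart_normK.
Qed.

Lemma L1norm0_eq0 u : L1norm u = 0 -> u = 0.
Proof.
rewrite -(L1reprK u) L1normE -L1class0; set f := L1repr u.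
move=> /(congr1 repart); rewrite of_realK repart0 => /eqP.
rewrite fine_eq0 ?L1integral_fin_num// => /eqP if0.
have [mf _] := integrable_funP f.
have mf' : measurable_fun setT (fun x => (rnorm (f x))%:E).
  by apply/measurable_EFinP; exact: Kmeasurable_norm.
have [/(_ _) + _] := ae_eq_integral_abs mu measurableT mf'.
have -> : (\int[mu]_x `|(rnorm (f x))%:E| = 0)%E.
  rewrite -[RHS]if0; apply: eq_integral => x _.
  by rewrite gee0_abs// lee_fin rnorm_ge0.
move=> /(_ erefl) f0; apply/L1classP.
by apply: filterS f0 => x /(_ I) [] /rnorm_eq0.
Qed.

HB.instance Definition _ :=
  Lmodule_isNormed.Build K L1 L1normD L1normZ L1norm0_eq0.

Lemma rnorm_L1class (f : integrable_fun) :
  rnorm (L1class f) = fine (L1integral f).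
Proof. by rewrite -[LHS]/(repart (L1norm _)) L1normE of_realK. Qed.

Lemma Kintegrable_indic (A : set Omega) (f : integrable_fun) : measurable A ->
  (fun x => \1_A x * f x) \in Kintegrable.
Proof.
move=> mA; have [mf intf] := integrable_funP f.
have mrA : measurable_fun setT (\1_A : Omega -> R) by exact: measurable_indic.
have E x : (\1_A x : K) = of_real (\1_A x).
  rewrite !indicE; case: (x \in A) => /=; last by rewrite of_real0.
  by rewrite /of_real; case: s.
have mAf : Kmeasurable (fun x => \1_A x * f x).
  split.
  - rewrite (_ : _ \o _ = fun x => \1_A x * repart (f x)); last first.
      by apply/funext => x /=; rewrite E repartZ.
    by apply: measurable_funM => //; case: mf.
  - rewrite (_ : _ \o _ = fun x => \1_A x * impart (f x)); last first.
      by apply/funext => x /=; rewrite E impartZ.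
    by apply: measurable_funM => //; case: mf.
apply/asboolP; split => //; apply: le_lt_trans intf.
apply: ge0_le_integral => //=.
- by move=> x _; rewrite lee_fin rnorm_ge0.
- by apply/measurable_EFinP; exact: Kmeasurable_norm.
- by apply/measurable_EFinP; exact: Kmeasurable_norm.
- move=> x _; rewrite lee_fin indicE; case: (x \in A) => /=.
    by rewrite mul1r.
  by rewrite mul0r /rnorm normr0 repart0 rnorm_ge0.
Qed.

Definition indic_mul (A : set Omega) (mA : measurable A) (u : L1) : L1 :=
  L1class (IntegrableFun (Kintegrable_indic (L1repr u) mA)).

Lemma indic_mulE (A : set Omega) (mA : measurable A) (f : integrable_fun) :
  indic_mul mA (L1class f) = L1class (IntegrableFun (Kintegrable_indic f mA)).
Proof.
apply/L1classP; have /L1classP := L1reprK (L1class f).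
by apply: filterS => x /= ->.
Qed.

End L1.

Section Representable.
Context (R : realType) (s : scalars).
Local Notation K := (scalar_field R s).
Context d (Omega : measurableType d) (mu : {finite_measure set Omega -> \bar R}).

Section Bochner.
Variable V : normedModType K.

Definition simple_function (g : Omega -> V) : Prop :=
  finite_set (range g) /\ forall v, measurable (g @^-1` [set v]).

Definition simple_integral (g : Omega -> V) : V :=
  \sum_(v \in range g) of_real (fine (mu (g @^-1` [set v]))) *: v.

Definition strongly_measurable (g : Omega -> V) : Prop :=
  exists g_ : nat -> Omega -> V, (forall n, simple_function (g_ n)) /\
    {ae mu, forall x, g_ n x @[n --> \oo] --> g x}.

Definition essentially_bounded (g : Omega -> V) : Prop :=
  exists C : R, {ae mu, forall x, rnorm (g x) <= C}.

(* y is the integral of g; stated as a relation, so that V need not be       *)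
(* complete.                                                                 *)
Definition is_Bochner_integral (g : Omega -> V) (y : V) : Prop :=
  strongly_measurable g /\
  exists g_ : nat -> Omega -> V,
    [/\ forall n, simple_function (g_ n),
        (\int[mu]_x (rnorm (g_ n x - g x))%:E)%E @[n --> \oo] --> 0%E &
        simple_integral (g_ n) @[n --> \oo] --> y].

End Bochner.

Definition representable (Y : normedModType K) (T : L1 s mu -> Y) : Prop :=
  bounded_operator T /\
  exists h : Omega -> Y,
    [/\ strongly_measurable h, essentially_bounded h &
        forall f : integrable_fun s mu,
          is_Bochner_integral (fun x => f x *: h x) (T (L1class f))].

Definition restrict_op (A : set Omega) (mA : measurable A)
    (Y : normedModType K) (T : L1 s mu -> Y) : L1 s mu -> Y :=
  fun u => T (indic_mul mA u).

End Representable.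

(* Main.v *)
Require Import Defs.
From HB Require Import structures.
From mathcomp Require Import all_boot all_order all_algebra.
From mathcomp Require Import ring lra complex finmap.
From mathcomp Require Import all_classical all_reals all_analysis.
From mathcomp Require Import measurable_realfun.

(* Every S in M is represented by a kernel h in L_oo(mu, L_1), so the domain
   splits, up to a set carrying little of the mass of x0, into finitely many
   pieces A on which S is almost of rank one: S(u 1_A) is close to f0(u 1_A) v.
   Testing against functionals equal to 1 on a set where v is nearly constant
   shows that the numerical radius of S is its norm, so S is a contraction.
   Since |f0(S x0)| is almost 1, most of the mass of x0 lies on pieces for which
   f0 almost attains its norm at S(x0 1_A)/|x0 1_A| (up to a common phase). On
   these pieces S is replaced by an exact rank-one operator u |-> f0(u 1_A) w,
   where w is a unit vector at which f1 attains its norm; the density of f1 is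
   that of f0, with its modulus rounded to 1 wherever it is nearly 1. Only
   finite-rank operators and a restriction of S are used, hence the new operator
   stays in M. *)

Set Implicit Arguments.
Unset Strict Implicit.
Unset Printing Implicit Defensive.
Import Order.TTheory GRing.Theory Num.Theory.
Import numFieldNormedType.Exports.

Local Open Scope classical_set_scope.
Local Open Scope ring_scope.

(** * Scalars *)

Section Scalars.
Context {R : realType} {s : scalars}.
Local Notation K := (scalar_field R s).
Implicit Types (x y z : K) (a b r : R).

(** The value 1 must be attained exactly by one pair, so all good pieces have to share a single
    functional f1. This dictates the order of the choices: f1 is obtained by rounding f0 without
    reference to the pieces, and each w is then adapted to f1. Rounding leaves the density unchanged
    where its modulus is already 1, which is why the pieces are cut inside that set: there f1 and f0
    agree, so the renormalised part of x0 on the good pieces is still normed by f1. The norm of L_1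
    is additive over disjoint sets, so contractions chosen piece by piece glue to a contraction;
    this keeps the numerical radius of the new operator at most 1. The constants: with tau = eps/8,
    moving a vector of the unit ball by O(tau) to a unit vector normed by f1 requires a defect of at
    most tau^2, and the pieces of larger defect have mass O(tau) once the total defect is of order
    tau^3. Hence eta = tau^3/4. *)

Definition mkK a b : K :=
  match s return scalar_field R s with
  | RealScalars => a
  | ComplexScalars => Complex a b
  end.

Lemma scalar_ext x y : repart x = repart y -> impart x = impart y -> x = y.
Proof.
by move: x y; rewrite /repart /impart; case: s => // -[a b] [c d] /= -> ->.
Qed.

Lemma repart_mkK a b : repart (mkK a b) = a.
Proof. by rewrite /repart /mkK; case: s. Qed.

Lemma impartN x : impart (- x) = - impart x.
Proof. by move: x; rewrite /impart; case: s => [x|[]]//=; rewrite oppr0. Qed.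

Lemma repartN x : repart (- x) = - repart x.
Proof. by move: x; rewrite /repart; case: s => // -[]. Qed.

Lemma repartB x y : repart (x - y) = repart x - repart y.
Proof. by rewrite repartD repartN. Qed.

Lemma impartB x y : impart (x - y) = impart x - impart y.
Proof. by rewrite impartD impartN. Qed.

Lemma repart_of_real a : repart (of_real a : K) = a.
Proof. exact: of_realK. Qed.

Lemma impart_of_real a : impart (of_real a : K) = 0.
Proof. by rewrite /impart /of_real; case: s. Qed.

Lemma of_real1 : of_real 1 = 1 :> K.
Proof. by rewrite /of_real; case: s. Qed.

Lemma repart1 : repart (1 : K) = 1.
Proof. by rewrite -of_real1 of_realK. Qed.

Lemma of_realN a : of_real (- a) = - of_real a :> K.
Proof. by apply: scalar_ext; rewrite ?repartN ?impartN ?repart_of_real ?impart_of_real ?oppr0. Qed.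

Lemma of_realB a b : of_real (a - b) = of_real a - of_real b :> K.
Proof. by rewrite of_realD of_realN. Qed.

Lemma rnormE x : rnorm x = Num.sqrt (repart x ^+ 2 + impart x ^+ 2).
Proof. exact: repart_normE. Qed.

Lemma rnorm_sqr x : rnorm x ^+ 2 = repart x ^+ 2 + impart x ^+ 2.
Proof. by rewrite rnormE sqr_sqrtr// addr_ge0// sqr_ge0. Qed.

Lemma rnormM x y : rnorm (x * y) = rnorm x * rnorm y.
Proof. by rewrite -[x * y]/(x *: (y : K^o)) [LHS]rnormZ. Qed.

Lemma rnorm_of_real a : rnorm (of_real a : K) = `|a|.
Proof.
by rewrite rnormE repart_of_real impart_of_real expr0n addr0 sqrtr_sqr.
Qed.

Lemma rnorm1 : rnorm (1 : K) = 1.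
Proof. by rewrite -of_real1 rnorm_of_real normr1. Qed.

Lemma ler_repart x : repart x <= rnorm x.
Proof.
rewrite rnormE; apply: (le_trans (ler_norm _)).
by rewrite -sqrtr_sqr ler_wsqrtr// lerDl sqr_ge0.
Qed.

Lemma normr_repart x : `|repart x| <= rnorm x.
Proof. by rewrite rnormE -sqrtr_sqr ler_wsqrtr// lerDl sqr_ge0. Qed.

Lemma normr_impart x : `|impart x| <= rnorm x.
Proof. by rewrite rnormE -sqrtr_sqr ler_wsqrtr// lerDr sqr_ge0. Qed.

Lemma rnorm_le_parts x : rnorm x <= `|repart x| + `|impart x|.
Proof.
rewrite -(@ler_pXn2r _ 2)// ?nnegrE ?rnorm_ge0 ?addr_ge0//.
rewrite rnorm_sqr -(real_normK (num_real (repart x))).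
rewrite -(real_normK (num_real (impart x))).
have := mulr_ge0 (normr_ge0 (repart x)) (normr_ge0 (impart x)).
by rewrite !expr2; lra.
Qed.

Lemma repart_eq_rnorm x : repart x = rnorm x -> x = of_real (rnorm x).
Proof.
move=> xE; apply: scalar_ext; rewrite ?repart_of_real// impart_of_real.
apply/eqP; rewrite -sqrf_eq0; apply/eqP.
by have := rnorm_sqr x; rewrite -xE; lra.
Qed.

Definition conjK x : K := mkK (repart x) (- impart x).

Lemma repart_conjK x : repart (conjK x) = repart x.
Proof. exact: repart_mkK. Qed.

Lemma impart_conjK x : impart (conjK x) = - impart x.
Proof.
by move: x; rewrite /conjK /mkK /impart; case: s => // x; rewrite oppr0.
Qed.

Lemma rnorm_conjK x : rnorm (conjK x) = rnorm x.
Proof. by rewrite !rnormE repart_conjK impart_conjK sqrrN. Qed.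

Lemma conjKM x : conjK x * x = of_real (rnorm x ^+ 2).
Proof.
apply: scalar_ext; rewrite ?repart_of_real ?impart_of_real ?repartM ?impartM.
  by rewrite repart_conjK impart_conjK rnorm_sqr; ring.
by rewrite repart_conjK impart_conjK; ring.
Qed.

(** This is the conjugate of the phase of x, so that [sgnK x * x] is |x|; the phase itself is
    [conjK (sgnK x)]. The value 1 at 0 makes it unimodular everywhere. *)
Definition sgnK x : K :=
  if rnorm x == 0 then 1 else of_real (rnorm x)^-1 * conjK x.

Lemma sgnKM x : sgnK x * x = of_real (rnorm x).
Proof.
rewrite /sgnK; case: eqVneq => [x0|x0].
  by rewrite (rnorm_eq0 x0) mulr0 /rnorm normr0 repart0 of_real0.
by rewrite -mulrA conjKM -of_realM expr2 mulrA mulVf// mul1r.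
Qed.

Lemma rnorm_sgnK x : rnorm (sgnK x) = 1.
Proof.
rewrite /sgnK; case: eqVneq => [x0|x0]; first exact: rnorm1.
by rewrite rnormM rnorm_conjK rnorm_of_real ger0_norm ?invr_ge0 ?rnorm_ge0// mulVf.
Qed.

Lemma conjK_unimodular x : rnorm x = 1 -> conjK x * x = 1.
Proof. by move=> x1; rewrite conjKM x1 expr1n of_real1. Qed.

Lemma rnorm0 (V : normedModType K) : rnorm (0 : V) = 0.
Proof. by rewrite /rnorm normr0 repart0. Qed.

Lemma rnormN (V : normedModType K) (v : V) : rnorm (- v) = rnorm v.
Proof. by rewrite /rnorm normrN. Qed.

Lemma rdistC (V : normedModType K) (u v : V) : rnorm (u - v) = rnorm (v - u).
Proof. by rewrite -rnormN opprB. Qed.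

Lemma rnormB (V : normedModType K) (u v : V) : rnorm (u - v) <= rnorm u + rnorm v.
Proof. by rewrite -(rnormN v) rnormD. Qed.

Lemma ler_rdist_add (V : normedModType K) (w u v : V) :
  rnorm (u - v) <= rnorm (u - w) + rnorm (w - v).
Proof. by rewrite (le_trans _ (rnormD _ _))// addrA subrK. Qed.

Lemma ler_rnormB (V : normedModType K) (u v : V) : rnorm u - rnorm v <= rnorm (u - v).
Proof. by rewrite lerBlDr -{1}(subrK v u) rnormD. Qed.

Lemma rnorm_sum (V : normedModType K) I (t : seq I) (P : pred I) (F : I -> V) :
  rnorm (\sum_(i <- t | P i) F i) <= \sum_(i <- t | P i) rnorm (F i).
Proof.
elim/big_ind2 : _ => [|x y x' y' xy xy'|]//; first by rewrite rnorm0.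
by rewrite (le_trans (rnormD _ _))// lerD.
Qed.

Lemma repart_sum I (t : seq I) (P : pred I) (F : I -> K) :
  repart (\sum_(i <- t | P i) F i) = \sum_(i <- t | P i) repart (F i).
Proof.
by apply: big_morph; [exact: repartD|exact: repart0].
Qed.

Lemma of_real_sum I (t : seq I) (P : pred I) (F : I -> R) :
  of_real (\sum_(i <- t | P i) F i) = \sum_(i <- t | P i) of_real (F i) :> K.
Proof.
by apply: big_morph; [exact: of_realD|exact: of_real0].
Qed.


(* When 1 - t <= |g|, put z = conj(sgnK g) * x and n = |z| = |x|: the square of
   the left-hand side is 2n(n - Re z), bounded by AM-GM. *)
Lemma rnorm_sub_phase_le (t : R) (g x : K) : 0 < t < 1 -> rnorm g <= 1 ->
  rnorm (x - (if 1 - t <= rnorm g then sgnK g * of_real (rnorm x) else 0)) <=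
  t * rnorm x + t^-1 * (rnorm x - repart (g * x)).
Proof.
move=> /andP[t0 t1] g1.
have x0 := rnorm_ge0 x; have g0 := rnorm_ge0 g.
have Hre : repart (g * x) <= rnorm g * rnorm x by rewrite -rnormM ler_repart.
case: ifPn => [gt|]; last first.
  (* For |g| < 1 - t the defect |x| - Re(g x) is at least t |x|, so the second term of the bound
     already dominates |x|. *)
  rewrite -ltNge subr0 => gt.
  rewrite -[leLHS]mul1r -(mulVf (lt0r_neq0 t0)) -mulrA.
  apply: (@le_trans _ _ (t^-1 * (rnorm x - repart (g * x)))); last first.
    by rewrite lerDr mulr_ge0// ltW.
  rewrite ler_wpM2l ?invr_ge0 ?(ltW t0)//.
  by have := ler_wpM2r x0 (ltW gt); nra.
pose u := conjK (sgnK g); pose z := u * x.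
have u1 : rnorm u = 1 by rewrite rnorm_conjK rnorm_sgnK.
have nz : rnorm z = rnorm x by rewrite rnormM u1 mul1r.
have su : u * sgnK g = 1 by rewrite conjK_unimodular// rnorm_sgnK.
have gE : g = of_real (rnorm g) * u.
  by rewrite -(sgnKM g) mulrAC [sgnK g * u]mulrC su mul1r.
have reE : repart (g * x) = rnorm g * repart z.
  by rewrite {1}gE -mulrA repartZ.
have -> : rnorm (x - sgnK g * of_real (rnorm x)) = rnorm (z - of_real (rnorm z)).
  rewrite nz -[LHS]mul1r -u1 -rnormM mulrBr [u * (sgnK g * _)]mulrA su mul1r.
  by [].
rewrite reE -nz.
have zr := normr_repart z; have nz0 := rnorm_ge0 z.
set a := rnorm g in g1 g0 *; set n := rnorm z in nz0 zr *.
have sq : rnorm (z - of_real n) ^+ 2 = 2 * n * (n - repart z).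
  rewrite rnorm_sqr repartB impartB repart_of_real impart_of_real.
  by have := rnorm_sqr z; rewrite -/n; nra.
have [zr1 zr2] : - n <= repart z /\ repart z <= n.
  by move: zr; rewrite ler_norml => /andP[].
have an : a * repart z <= n by nra.
have h2 : 0 <= t^-1 * (n - a * repart z).
  by rewrite mulr_ge0// ?invr_ge0 ?(ltW t0)// subr_ge0.
rewrite -(@ler_pXn2r _ 2)// ?nnegrE ?rnorm_ge0//; last first.
  by rewrite addr_ge0// mulr_ge0// ltW.
rewrite sq.
(* Passing from n - Re z to the defect n - a Re z costs a factor 2, because 0 <= a <= 1 and |Re z|
   <= n. The new bound is four times the product of the two terms on the right-hand side, hence at
   most the square of their sum. *)
apply: (@le_trans _ _ (4 * n * (n - a * repart z))).
  rewrite -subr_ge0 (_ : _ - _ =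
    2 * (n * ((1 - a) * (n + repart z) + a * (n - repart z)))); last by ring.
  by rewrite mulr_ge0// mulr_ge0// addr_ge0// mulr_ge0//; lra.
have -> : 4 * n * (n - a * repart z) =
  4 * (t * n) * (t^-1 * (n - a * repart z)).
  have -> : 4 * (t * n) * (t^-1 * (n - a * repart z)) =
    (t * t^-1) * (4 * n * (n - a * repart z)) by ring.
  by rewrite divff ?mul1r// lt0r_neq0.
by have := sqr_ge0 (t * n - t^-1 * (n - a * repart z)); nra.
Qed.

End Scalars.

(** * Real integrals over a finite measure *)

Section RealIntegral.
Context {R : realType} {d} {Omega : measurableType d}.
Context {mu : {finite_measure set Omega -> \bar R}}.
Implicit Types F G : Omega -> R.

Definition rintegrable F := mu.-integrable setT (EFin \o F).

Lemma rintegrable_measurable F : rintegrable F -> measurable_fun setT F.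
Proof. by case/integrableP => /measurable_EFinP. Qed.

Lemma rintegrableD F G : rintegrable F -> rintegrable G ->
  rintegrable (fun x => F x + G x).
Proof. by move=> iF iG; exact: integrableD iF iG. Qed.

Lemma rintegrableB F G : rintegrable F -> rintegrable G ->
  rintegrable (fun x => F x - G x).
Proof. by move=> iF iG; exact: integrableB iF iG. Qed.

Lemma rintegrableZ (a : R) F : rintegrable F -> rintegrable (fun x => a * F x).
Proof. by move=> iF; exact: integrableZl iF. Qed.

Lemma rintegrable_dom F G : measurable_fun setT F -> rintegrable G ->
  (forall x, `|F x| <= G x) -> rintegrable F.
Proof.
move=> mF iG FG; apply: le_integrable iG => //; first exact/measurable_EFinP.
by move=> x _ /=; rewrite lee_fin (le_trans (FG x))// ler_norm.
Qed.

Lemma rintegrable_cst (a : R) : rintegrable (fun=> a).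
Proof. exact: (@finite_measure_integrable_cst _ _ _ mu setT a). Qed.

Lemma rintegrable_norm F : rintegrable F -> rintegrable (fun x => `|F x|).
Proof. exact: integrable_norm. Qed.

Lemma eq_Rintegral_ae F G : measurable_fun setT F -> measurable_fun setT G ->
  {ae mu, forall x, F x = G x} -> \int[mu]_x F x = \int[mu]_x G x.
Proof.
move=> mF mG FG; congr fine; apply: ae_eq_integral => //.
- exact/measurable_EFinP.
- exact/measurable_EFinP.
- by apply: filterS FG => x /= + _; move=> ->.
Qed.

Lemma le_Rintegral_ae F G : rintegrable F -> rintegrable G ->
  {ae mu, forall x, F x <= G x} -> \int[mu]_x F x <= \int[mu]_x G x.
Proof.
move=> iF iG FG; rewrite -subr_ge0 -RintegralB//.
have iH := rintegrableB iG iF.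
rewrite (@eq_Rintegral_ae _ (fun x => `|G x - F x|)).
- by apply: Rintegral_ge0.
- exact: rintegrable_measurable.
- exact/rintegrable_measurable/rintegrable_norm.
- by apply: filterS FG => x FGx; rewrite ger0_norm// subr_ge0.
Qed.

Lemma Rintegral_eq0_ae F : rintegrable F -> {ae mu, forall x, 0 <= F x} ->
  \int[mu]_x F x <= 0 -> {ae mu, forall x, F x = 0}.
Proof.
move=> iF F0 IF0.
have mF := rintegrable_measurable iF.
have E : \int[mu]_x `|F x| = 0.
  apply/le_anti; rewrite Rintegral_ge0// andbT.
  rewrite (@eq_Rintegral_ae _ F)//.
    exact/rintegrable_measurable/rintegrable_norm.
  by apply: filterS F0 => x Fx; rewrite ger0_norm.
have [/(_ _) h _] := ae_eq_integral_abs mu measurableT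
  (iffRL (measurable_EFinP _ _) mF : measurable_fun setT (EFin \o F)).
have /h H : (\int[mu]_x `|(EFin \o F) x| = 0)%E.
  rewrite -[LHS]fineK ?[fine _]E//.
  by rewrite (@integrable_fin_num _ _ _ mu)//; exact: integrable_abse iF.
by apply: filterS H => x /(_ I)[].
Qed.

(** Dominated convergence with majorant |F|. It serves twice: to discard the points where simple
    approximants have not yet settled, and to make the tails of a disjoint union negligible. *)
Lemma cvg_Rintegral_indic0 F (D : (set Omega)^nat) : rintegrable F ->
  (forall n, measurable (D n)) ->
  {ae mu, forall x, \forall n \near \oo, ~ D n x} ->
  \int[mu]_x (\1_(D n) x * F x) @[n --> \oo] --> 0.
Proof.
move=> iF mD D0.
have mF := rintegrable_measurable iF.
have mDF n : measurable_fun setT (fun x => \1_(D n) x * F x).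
  by apply: measurable_funM => //; exact: measurable_indic.
have [] := @dominated_convergence _ _ _ mu setT measurableT
  (fun n x => (\1_(D n) x * F x)%:E) (cst 0%E) (fun x => `|F x|%:E)
  (fun n => iffRL (measurable_EFinP _ _) (mDF n)) (measurable_cst _).
- apply: filterS D0 => x Dx _; apply: cvg_near_cst.
  by apply: filterS Dx => n Dnx; rewrite indicE memNset// mul0r.
- exact: rintegrable_norm.
- apply: aeW => x n _; rewrite lee_fin normrM ler_piMl//.
  by rewrite indicE; case: (_ \in _); rewrite ?normr1 ?normr0.
- by move=> _ _; rewrite integral0 => /fine_cvg.
Qed.

(** The integral of a nonnegative function is a supremum over the simple functions below it, so
    monotonicity holds without measurability. The distance to a Bochner integrand, met below, comes
    with no measurability. *)
Lemma nn_le_integral (f g : Omega -> \bar R) : (forall x, 0 <= f x)%E ->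
  (forall x, f x <= g x)%E -> (\int[mu]_x f x <= \int[mu]_x g x)%E.
Proof.
move=> f0 fg; rewrite !ge0_integralTE//; last first.
  by move=> x; exact: le_trans (fg x).
apply/ge_ereal_sup => /= _ [h hf <-].
by apply: ereal_sup_ubound => /=; exists h => // x; exact: le_trans (fg x).
Qed.

End RealIntegral.
Arguments rintegrable {R d Omega} mu F.

(** * Scalar-valued integrals *)

Section ScalarIntegral.
Context {R : realType} {s : scalars} {d} {Omega : measurableType d}.
Context {mu : {finite_measure set Omega -> \bar R}}.
Local Notation K := (scalar_field R s).
Implicit Types (f g : Omega -> K) (F : Omega -> R).

Lemma Kmeasurable_cst (c : K) : Kmeasurable (fun _ : Omega => c).
Proof. by split; exact: measurable_cst. Qed.

Lemma KmeasurableM f g : Kmeasurable f -> Kmeasurable g ->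
  Kmeasurable (fun x => f x * g x).
Proof.
move=> [fr fi] [gr gi]; split.
- rewrite (_ : _ \o _ = fun x => repart (f x) * repart (g x)
    - impart (f x) * impart (g x)).
    by apply: measurable_funB; exact: measurable_funM.
  by apply/funext => x /=; rewrite repartM.
- rewrite (_ : _ \o _ = fun x => repart (f x) * impart (g x)
    + impart (f x) * repart (g x)).
    by apply: measurable_funD; exact: measurable_funM.
  by apply/funext => x /=; rewrite impartM.
Qed.

Lemma KmeasurableD f g : Kmeasurable f -> Kmeasurable g ->
  Kmeasurable (fun x => f x + g x).
Proof.
move=> mf mg; have := Kmeasurable_lin 1 mf mg.
by rewrite (_ : _ + _ = (fun x => f x + g x))// scale1r.
Qed.

Lemma KmeasurableZ (c : K) f : Kmeasurable f -> Kmeasurable (fun x => c * f x).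
Proof. by apply: KmeasurableM; exact: Kmeasurable_cst. Qed.

Lemma KmeasurableB f g : Kmeasurable f -> Kmeasurable g ->
  Kmeasurable (fun x => f x - g x).
Proof.
move=> mf mg; rewrite (_ : (fun x => _) = (fun x => f x + (-1) * g x)).
  exact/KmeasurableD/KmeasurableZ.
by apply/funext => x; rewrite mulN1r.
Qed.

Lemma Kmeasurable_of_real F : measurable_fun setT F ->
  Kmeasurable (fun x => of_real (F x) : K).
Proof.
move=> mF; split.
- by rewrite (_ : _ \o _ = F)//; apply/funext => x /=; rewrite repart_of_real.
- rewrite (_ : _ \o _ = cst 0); first exact: measurable_cst.
  by apply/funext => x /=; rewrite impart_of_real.
Qed.

Lemma indic_of_real (A : set Omega) x : \1_A x = of_real (\1_A x) :> K.
Proof. by rewrite !indicE; case: (_ \in _); rewrite ?of_real0 ?of_real1. Qed.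

Lemma Kmeasurable_indic (A : set Omega) : measurable A ->
  Kmeasurable (fun x => \1_A x : K).
Proof.
move=> mA; rewrite (_ : (fun x => _) = (fun x => of_real (\1_A x) : K)).
  by apply: Kmeasurable_of_real; exact: measurable_indic.
by apply/funext => x; exact: indic_of_real.
Qed.

Lemma Kmeasurable_conjK f : Kmeasurable f -> Kmeasurable (fun x => conjK (f x)).
Proof.
move=> [fr fi]; split.
- by rewrite (_ : _ \o _ = repart \o f)//; apply/funext => x /=; rewrite repart_conjK.
- rewrite (_ : _ \o _ = fun x => - impart (f x)).
    by apply: measurable_funN.
  by apply/funext => x /=; rewrite impart_conjK.
Qed.

Lemma measurable_rnorm_le f (r : R) : Kmeasurable f ->
  measurable [set x | rnorm (f x) <= r].
Proof.
move=> /Kmeasurable_norm mf; rewrite -[X in measurable X]setTI.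
by apply: measurable_fun_le => //; exact: measurable_cst.
Qed.

Lemma measurable_rnorm_eq f (r : R) : Kmeasurable f ->
  measurable [set x | rnorm (f x) = r].
Proof.
move=> /Kmeasurable_norm mf; rewrite -[X in measurable X]setTI.
exact: (mf measurableT [set r] (measurable_set1 _)).
Qed.

Lemma Kmeasurable_if (A : set Omega) f g : measurable A ->
  Kmeasurable f -> Kmeasurable g ->
  Kmeasurable (fun x => if x \in A then f x else g x).
Proof.
move=> mA mf mg.
rewrite (_ : (fun x => _) = (fun x => \1_A x * f x + \1_(~` A) x * g x)).
  apply: KmeasurableD; apply: KmeasurableM => //; apply: Kmeasurable_indic => //.
  exact: measurableC.
apply/funext => x; rewrite !indicE in_setC; case: (x \in A) => /=.
  by rewrite mul1r mul0r addr0.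
by rewrite mul1r mul0r add0r.
Qed.

Lemma Kmeasurable_sgnK f : Kmeasurable f -> Kmeasurable (fun x => sgnK (f x)).
Proof.
move=> mf; pose A := [set x | rnorm (f x) = 0].
(* The inverse is written as the power -1, whose measurability is at hand; the two agree on
   nonnegative reals. *)
rewrite (_ : (fun x => _) = (fun x => if x \in A then 1
    else of_real (rnorm (f x) `^ (-1)) * conjK (f x))).
  apply: Kmeasurable_if; [exact: measurable_rnorm_eq|exact: Kmeasurable_cst|].
  apply: KmeasurableM; last exact: Kmeasurable_conjK.
  apply: Kmeasurable_of_real.
  exact: (measurableT_comp (measurable_powR (-1)) (Kmeasurable_norm mf)).

apply/funext => x; rewrite /sgnK; case: ifPn => [/eqP x0|x0].
  by rewrite mem_set.
by rewrite memNset ?powR_inv1 ?rnorm_ge0//; apply/eqP.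
Qed.

Definition Kint_able f : Prop :=
  Kmeasurable f /\ rintegrable mu (fun x => rnorm (f x)).

Lemma Kint_ableP f : (f \in Kintegrable mu) <-> Kint_able f.
Proof.
split => [/asboolP[mf iF]|[mf /integrableP[_ iF]]].
  split => //; apply/integrableP; split.
    exact/measurable_EFinP/Kmeasurable_norm.
  rewrite (_ : (\int[mu]_x _ = L1integral mu f)%E)//.
  by apply: eq_integral => x _ /=; rewrite ger0_norm ?rnorm_ge0.
apply/asboolP; split => //.
rewrite (_ : (L1integral mu f = \int[mu]_x `|(EFin \o (fun x => rnorm (f x))) x|)%E)//.
by apply: eq_integral => x _ /=; rewrite ger0_norm ?rnorm_ge0.
Qed.

Lemma Kint_able_dom f F : Kmeasurable f -> rintegrable mu F ->
  (forall x, rnorm (f x) <= F x) -> Kint_able f.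
Proof.
move=> mf iF fF; split => //; apply: rintegrable_dom iF _.
  exact: Kmeasurable_norm.
by move=> x; rewrite ger0_norm ?rnorm_ge0.
Qed.

Lemma Kint_ableD f g : Kint_able f -> Kint_able g ->
  Kint_able (fun x => f x + g x).
Proof.
move=> [mf jf] [mg jg]; apply: (Kint_able_dom _ (rintegrableD jf jg)).
  exact: KmeasurableD.
by move=> x; exact: rnormD.
Qed.

Lemma Kint_ableZ (c : K) f : Kint_able f -> Kint_able (fun x => c * f x).
Proof.
move=> [mf jf]; apply: (Kint_able_dom _ (rintegrableZ (rnorm c) jf)).
  exact: KmeasurableZ.
by move=> x; rewrite rnormM.
Qed.

Lemma Kint_ableB f g : Kint_able f -> Kint_able g ->
  Kint_able (fun x => f x - g x).
Proof.
move=> jf jg; rewrite (_ : (fun x => _) = (fun x => f x + (-1) * g x)).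
  exact/Kint_ableD/Kint_ableZ.
by apply/funext => x; rewrite mulN1r.
Qed.

Lemma Kint_able_bounded f (C : R) : Kmeasurable f ->
  (forall x, rnorm (f x) <= C) -> Kint_able f.
Proof. by move=> mf fC; exact: (Kint_able_dom mf (rintegrable_cst C)). Qed.

Lemma Kint_ableM (C : R) f g : Kmeasurable g -> (forall x, rnorm (g x) <= C) ->
  Kint_able f -> Kint_able (fun x => g x * f x).
Proof.
move=> mg gC [mf jf]; apply: (Kint_able_dom _ (rintegrableZ C jf)).
  exact: KmeasurableM.
by move=> x; rewrite rnormM ler_wpM2r// rnorm_ge0.
Qed.

Definition Kint f : K :=
  mkK (\int[mu]_x repart (f x)) (\int[mu]_x impart (f x)).

Lemma repart_Kint f : repart (Kint f) = \int[mu]_x repart (f x).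
Proof. exact: repart_mkK. Qed.

Lemma impart_Kint f : impart (Kint f) = \int[mu]_x impart (f x).
Proof.
rewrite /Kint; move: f; rewrite /mkK /impart; case: s => // f.
by rewrite Rintegral_cst// mul0r.
Qed.

Lemma rintegrable_repart f : Kint_able f -> rintegrable mu (fun x => repart (f x)).
Proof.
move=> [mf jf]; apply: rintegrable_dom jf _; first by case: mf.
by move=> x; exact: normr_repart.
Qed.

Lemma rintegrable_impart f : Kint_able f -> rintegrable mu (fun x => impart (f x)).
Proof.
move=> [mf jf]; apply: rintegrable_dom jf _; first by case: mf.
by move=> x; exact: normr_impart.
Qed.

Lemma KintD f g : Kint_able f -> Kint_able g ->
  Kint (fun x => f x + g x) = Kint f + Kint g.
Proof.
move=> jf jg; apply: scalar_ext.
  rewrite repartD !repart_Kint -RintegralD//; try exact: rintegrable_repart.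
  by apply: eq_Rintegral => x _; exact: repartD.
rewrite impartD !impart_Kint -RintegralD//; try exact: rintegrable_impart.
by apply: eq_Rintegral => x _; exact: impartD.
Qed.

Lemma KintZ (c : K) f : Kint_able f -> Kint (fun x => c * f x) = c * Kint f.
Proof.
move=> jf; have jr := rintegrable_repart jf; have ji := rintegrable_impart jf.
apply: scalar_ext.
  rewrite repartM !repart_Kint impart_Kint -!RintegralZl// -RintegralB//;
    try exact: rintegrableZ.
  by apply: eq_Rintegral => x _; exact: repartM.
rewrite impartM !impart_Kint repart_Kint -!RintegralZl// -RintegralD//;
  try exact: rintegrableZ.
by apply: eq_Rintegral => x _; exact: impartM.
Qed.

Lemma KintB f g : Kint_able f -> Kint_able g ->
  Kint (fun x => f x - g x) = Kint f - Kint g.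
Proof.
move=> jf jg; rewrite -mulN1r -KintZ// -KintD//; last exact: Kint_ableZ.
by congr Kint; apply/funext => x; rewrite mulN1r.
Qed.

Lemma Kint0 : Kint (fun=> 0) = 0.
Proof.
apply: scalar_ext; rewrite ?repart_Kint ?impart_Kint.
  by rewrite Rintegral_cst// repart0 mul0r.
by rewrite Rintegral_cst// impart0 mul0r.
Qed.

Lemma Kint_able_sum I (t : seq I) (P : pred I) (f : I -> Omega -> K) :
  (forall i, Kint_able (f i)) ->
  Kint_able (fun x => \sum_(i <- t | P i) f i x).
Proof.
move=> jf; elim: t => [|i t IH].
  rewrite (_ : (fun x => _) = fun=> 0).
    by apply: (@Kint_able_bounded _ 0) => [|x]; [exact: Kmeasurable_cst|rewrite rnorm0].
  by apply/funext => x; rewrite big_nil.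
case: (boolP (P i)) => Pi.
  rewrite (_ : (fun x => _) = fun x => f i x + \sum_(i <- t | P i) f i x).
    exact: Kint_ableD.
  by apply/funext => x; rewrite big_cons Pi.
rewrite (_ : (fun x => _) = fun x => \sum_(i <- t | P i) f i x)//.
by apply/funext => x; rewrite big_cons (negPf Pi).
Qed.

Lemma Kint_sum I (t : seq I) (P : pred I) (f : I -> Omega -> K) :
  (forall i, Kint_able (f i)) ->
  Kint (fun x => \sum_(i <- t | P i) f i x) = \sum_(i <- t | P i) Kint (f i).
Proof.
move=> jf; elim: t => [|i t IH].
  by rewrite big_nil -[RHS]Kint0; congr Kint; apply/funext => x; rewrite big_nil.
rewrite big_cons -IH; case: ifPn => Pi.
  rewrite -KintD//; last exact: Kint_able_sum.
  by congr Kint; apply/funext => x; rewrite big_cons Pi.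
by congr Kint; apply/funext => x; rewrite big_cons (negPf Pi).
Qed.

Lemma Kint_ae f g : Kmeasurable f -> Kmeasurable g ->
  {ae mu, forall x, f x = g x} -> Kint f = Kint g.
Proof.
move=> [fr fi] [gr gi] fg; apply: scalar_ext.
  rewrite !repart_Kint; apply: eq_Rintegral_ae => //.
  by apply: filterS fg => x ->.
rewrite !impart_Kint; apply: eq_Rintegral_ae => //.
by apply: filterS fg => x ->.
Qed.

Lemma Kint_of_real F : rintegrable mu F ->
  Kint (fun x => of_real (F x)) = of_real (\int[mu]_x F x).
Proof.
move=> iF; apply: scalar_ext.
  rewrite repart_Kint repart_of_real; apply: eq_Rintegral => x _.
  exact: repart_of_real.
rewrite impart_Kint impart_of_real -[RHS](mul0r (fine (mu setT))).
rewrite -Rintegral_cst//; apply: eq_Rintegral => x _.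
exact: impart_of_real.
Qed.

(** Multiplying by the conjugate phase of the integral turns its modulus into the real part of an
    integral, which is compared pointwise. *)
Lemma rnorm_Kint_le f : Kint_able f -> rnorm (Kint f) <= \int[mu]_x rnorm (f x).
Proof.
move=> jf; rewrite -(@repart_of_real R s (rnorm (Kint f))) -sgnKM -KintZ// repart_Kint.
have jg := Kint_ableZ (sgnK (Kint f)) jf.
apply: le_Rintegral => //; first exact: rintegrable_repart.
  by case: jf.
by move=> x _; rewrite (le_trans (ler_repart _))// rnormM rnorm_sgnK mul1r.
Qed.

End ScalarIntegral.
Arguments Kint {R s d Omega} mu f.
Arguments Kint_able {R s d Omega} mu f.

(** * Operators, functionals and the numerical radius *)

Section OperatorNorm.
Context {R : realType} {s : scalars}.
Local Notation K := (scalar_field R s).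

Lemma rnormZ_of_real (V : normedModType K) (r : R) (v : V) : 0 <= r ->
  rnorm (of_real r *: v) = r * rnorm v.
Proof. by move=> r0; rewrite rnormZ rnorm_of_real ger0_norm. Qed.

Definition linear_map (X Y : normedModType K) (T : X -> Y) : Prop := linear T.

Section Ops.
Variables X Y : normedModType K.
Implicit Type T : X -> Y.

Lemma linearD_of T : linear_map T -> {morph T : u v / u + v}.
Proof. by move=> lT u v; have := lT 1 u v; rewrite !scale1r. Qed.

Lemma linear0_of T : linear_map T -> T 0 = 0.
Proof.
by move=> lT; have := lT (-1) 0 0; rewrite scaler0 addr0 scaleN1r addNr.
Qed.

Lemma linearZ_of T : linear_map T -> forall (c : K) u, T (c *: u) = c *: T u.
Proof. by move=> lT c u; have := lT c u 0; rewrite !addr0 linear0_of// addr0. Qed.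

Lemma linearB_of T : linear_map T -> {morph T : u v / u - v}.
Proof.
by move=> lT u v; rewrite -scaleN1r linearD_of// linearZ_of// scaleN1r.
Qed.

Lemma linear_sum_of T I (t : seq I) (P : pred I) (F : I -> X) : linear_map T ->
  T (\sum_(i <- t | P i) F i) = \sum_(i <- t | P i) T (F i).
Proof. by move=> lT; apply: big_morph; [exact: linearD_of|exact: linear0_of]. Qed.

Lemma opnorm_le T (C : R) : 0 <= C -> (forall x, rnorm (T x) <= C * rnorm x) ->
  opnorm T <= C.
Proof.
move=> C0 TC; apply: ge_sup.
  by exists (rnorm (T 0)), 0 => //=; rewrite rnorm0.
move=> _ [x /= x1 <-]; apply: le_trans (TC x) _.
by rewrite -[leRHS]mulr1 ler_wpM2l.
Qed.

Lemma opnorm_ge T x : bounded_operator T -> rnorm x <= 1 -> rnorm (T x) <= opnorm T.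
Proof.
move=> [_ [C TC]] x1; apply: ub_le_sup; last by exists x.
exists `|C| => _ [y /= y1 <-]; apply: le_trans (TC y) _.
rewrite (@le_trans _ _ (`|C| * rnorm y))// ?ler_wpM2r ?rnorm_ge0 ?ler_norm//.
by rewrite -[leRHS]mulr1 ler_wpM2l.
Qed.

Lemma rnorm_le_opnorm T x : bounded_operator T ->
  rnorm (T x) <= opnorm T * rnorm x.
Proof.
move=> bT; have [x0|x0] := eqVneq (rnorm x) 0.
  by rewrite (rnorm_eq0 x0) (linear0_of (proj1 bT)) !rnorm0 mulr0.
have xp : 0 < rnorm x by rewrite lt0r x0 rnorm_ge0.
have := @opnorm_ge T (of_real (rnorm x)^-1 *: x) bT.
rewrite (linearZ_of (proj1 bT)) !rnormZ_of_real ?invr_ge0 ?rnorm_ge0// mulVf//.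
by move=> /(_ (lexx _)); rewrite mulrC ler_pdivrMr.
Qed.

End Ops.

Section NumericalRadius.
Variable X : normedModType K.
Implicit Type T : X -> X.

Lemma dual_sphere_le (f : X -> K) x : dual_sphere f -> rnorm (f x) <= rnorm x.
Proof. by move=> [bf f1]; have := rnorm_le_opnorm x bf; rewrite f1 mul1r. Qed.

Lemma dual_sphere_of (f : X -> K) x : @linear_map X K f ->
  (forall u, rnorm (f u) <= rnorm u) -> sphere x -> f x = 1 -> dual_sphere f.
Proof.
move=> lf f1 x1 fx; have bf : @bounded_operator R s X K f.
  by split => //; exists 1 => u; rewrite mul1r.
split => //; apply/le_anti/andP; split.
  by apply: opnorm_le => // u; rewrite mul1r.
have := @opnorm_ge X K f x bf; rewrite fx rnorm1 => -> //.
by rewrite [rnorm x]x1.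
Qed.

Lemma numerical_radius_le T (C : R) : 0 <= C ->
  (forall x, rnorm (T x) <= C * rnorm x) -> numerical_radius T <= C.
Proof.
move=> C0 TC; rewrite /numerical_radius; set A := [set _ | _].
(* Without any norming pair, as in the zero space, the supremum is 0 by convention. *)
have [A0|/set0P nA] := eqVneq A set0; first by rewrite A0 sup0.
apply: ge_sup => // _ [x [f [x1 f1 _ ->]]].
by rewrite (le_trans (dual_sphere_le _ f1))// (le_trans (TC x))// [rnorm x]x1 mulr1.
Qed.

Lemma numerical_radius_ge T x (f : X -> K) : bounded_operator T ->
  sphere x -> dual_sphere f -> f x = 1 -> rnorm (f (T x)) <= numerical_radius T.
Proof.
move=> bT x1 f1 fx; apply: ub_le_sup; last by exists x, f.
exists (opnorm T) => _ [y [g [y1 g1 _ ->]]].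
rewrite (le_trans (dual_sphere_le _ g1))// (le_trans (rnorm_le_opnorm y bT))//.
by rewrite [rnorm y]y1 mulr1.
Qed.

End NumericalRadius.

End OperatorNorm.

(** * Classes in L_1, multiplication by bounded functions and the duality pairing *)

Section L1Layer.
Context {R : realType} {s : scalars} {d} {Omega : measurableType d}.
Context {mu : {finite_measure set Omega -> \bar R}}.
Local Notation K := (scalar_field R s).
Local Notation L1 := (L1 s mu).
Implicit Types (f g : Omega -> K) (u v : L1) (A : set Omega).

(** A total version of [L1class], with junk value 0, so that classes of explicit functions can be
    written without integrability proofs inside the terms. *)
Definition cls f : L1 :=
  if pselect (f \in Kintegrable mu) is left fI then L1class (IntegrableFun fI)
  else 0.

Lemma clsE f (fI : f \in Kintegrable mu) : cls f = L1class (IntegrableFun fI).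
Proof.
by rewrite /cls; case: pselect => // fI'; rewrite (Prop_irrelevance fI fI').
Qed.

Lemma cls_val (f : integrable_fun s mu) : cls f = L1class f.
Proof. by case: f => f fI; rewrite (clsE fI). Qed.

Lemma cls_repr u : cls (L1repr u) = u.
Proof. by rewrite cls_val L1reprK. Qed.

Lemma Kint_able_val (f : integrable_fun s mu) : Kint_able mu f.
Proof. exact/Kint_ableP/integrable_valP. Qed.

Lemma Kint_able_repr u : Kint_able mu (L1repr u).
Proof. exact: Kint_able_val. Qed.

Lemma repr_cls f : Kint_able mu f -> {ae mu, forall x, L1repr (cls f) x = f x}.
Proof.
move=> /Kint_ableP fI; rewrite (clsE fI).
exact: (iffLR (L1classP _ _) (L1reprK (L1class (IntegrableFun fI)))).
Qed.

Lemma cls_ae f g : Kint_able mu f -> Kint_able mu g ->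
  {ae mu, forall x, f x = g x} -> cls f = cls g.
Proof.
by move=> /Kint_ableP fI /Kint_ableP gI fg; rewrite (clsE fI) (clsE gI); apply/L1classP.
Qed.

Lemma clsD f g : Kint_able mu f -> Kint_able mu g ->
  cls (fun x => f x + g x) = cls f + cls g.
Proof.
move=> jf jg; have /Kint_ableP fI := jf; have /Kint_ableP gI := jg.
have /Kint_ableP fgI := Kint_ableD jf jg.
rewrite (clsE fI) (clsE gI) (clsE fgI) -L1classD; apply/L1classP.
exact: aeW.
Qed.

Lemma clsZ (c : K) f : Kint_able mu f -> cls (fun x => c * f x) = c *: cls f.
Proof.
move=> jf; have /Kint_ableP fI := jf.
have /Kint_ableP cfI := Kint_ableZ c jf.
rewrite (clsE fI) (clsE cfI) -[RHS]/(L1scale c _) -L1classZ; apply/L1classP.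
exact: aeW.
Qed.

Lemma clsB f g : Kint_able mu f -> Kint_able mu g ->
  cls (fun x => f x - g x) = cls f - cls g.
Proof.
move=> jf jg; rewrite -[- cls g]scaleN1r -clsZ// -clsD//; last exact: Kint_ableZ.
by congr cls; apply/funext => x; rewrite mulN1r.
Qed.

Lemma rnorm_cls f : Kint_able mu f -> rnorm (cls f) = \int[mu]_x rnorm (f x).
Proof. by move=> /Kint_ableP fI; rewrite (clsE fI) rnorm_L1class. Qed.

Lemma rnorm_L1 u : rnorm u = \int[mu]_x rnorm (L1repr u x).
Proof. by rewrite -{1}(cls_repr u) rnorm_cls//; exact: Kint_able_repr. Qed.

(** Elements of L_oo are handled as genuine functions with a bound at every point;
    [riesz_representation] produces densities in this form. *)
Definition bounded_by (C : R) g : Prop :=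
  Kmeasurable g /\ forall x, rnorm (g x) <= C.

Lemma bounded_by_indic A : measurable A -> bounded_by 1 (fun x => \1_A x : K).
Proof.
move=> mA; split; first exact: Kmeasurable_indic.
by move=> x; rewrite indicE; case: (_ \in _); rewrite ?rnorm1 ?rnorm0.
Qed.

Lemma bounded_byM C g f : bounded_by C g -> Kint_able mu f ->
  Kint_able mu (fun x => g x * f x).
Proof. by move=> [mg gC]; exact: Kint_ableM gC. Qed.

Lemma bounded_by_mul C D g h : bounded_by C g -> bounded_by D h ->
  bounded_by (C * D) (fun x => g x * h x).
Proof.
move=> [mg gC] [mh hD]; split; first exact: KmeasurableM.
by move=> x; rewrite rnormM ler_pM ?rnorm_ge0.
Qed.

Lemma bounded_by_mul1 g h : bounded_by 1 g -> bounded_by 1 h ->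
  bounded_by 1 (fun x => g x * h x).
Proof. by move=> bg bh; rewrite -(mulr1 1); exact: bounded_by_mul. Qed.

(** Both [mulL] and [pairing] are computed on the chosen representative of u; for bounded g,
    [mulL_cls] and [pairing_cls] show that any other representative gives the same result. *)
Definition mulL g u : L1 := cls (fun x => g x * L1repr u x).

Definition pairing g u : K := Kint mu (fun x => g x * L1repr u x).

Lemma indic_mul_mulL A (mA : measurable A) u :
  indic_mul mA u = mulL (fun x => \1_A x) u.
Proof. by rewrite /indic_mul /mulL -clsE. Qed.

Section Fixed.
Variables (C : R) (g : Omega -> K).
Hypothesis bg : bounded_by C g.

Lemma mulL_cls f : Kint_able mu f -> mulL g (cls f) = cls (fun x => g x * f x).
Proof.
move=> jf; apply: cls_ae.
- exact: (bounded_byM bg (Kint_able_repr _)).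
- exact: (bounded_byM bg jf).
- by apply: filterS (repr_cls jf) => x ->.
Qed.

Lemma pairing_cls f : Kint_able mu f ->
  pairing g (cls f) = Kint mu (fun x => g x * f x).
Proof.
move=> jf; apply: Kint_ae.
- by case: (bounded_byM bg (Kint_able_repr (cls f))).
- by case: (bounded_byM bg jf).
- by apply: filterS (repr_cls jf) => x ->.
Qed.

Lemma mulL_linear : linear_map (mulL g).
Proof.
move=> c u v; rewrite -(cls_repr u) -(cls_repr v).
have [ju jv] := (Kint_able_repr u, Kint_able_repr v).
rewrite -clsZ// -clsD//; last exact: Kint_ableZ.
rewrite !mulL_cls//; last by apply: Kint_ableD => //; exact: Kint_ableZ.
have gu := bounded_byM bg ju; have gv := bounded_byM bg jv.
rewrite -clsZ// -clsD//; last exact: Kint_ableZ.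
by congr cls; apply/funext => x; rewrite mulrDr mulrCA.
Qed.

Lemma pairing_linear : @linear_map R s L1 K (pairing g).
Proof.
move=> c u v; rewrite -(cls_repr u) -(cls_repr v).
have [ju jv] := (Kint_able_repr u, Kint_able_repr v).
rewrite -clsZ// -clsD//; last exact: Kint_ableZ.
rewrite !pairing_cls//; last by apply: Kint_ableD => //; exact: Kint_ableZ.
have gu := bounded_byM bg ju; have gv := bounded_byM bg jv.
rewrite -[c *: _]KintZ// -KintD//; last exact: Kint_ableZ.
by congr Kint; apply/funext => x; rewrite mulrDr mulrCA.
Qed.

Lemma rnorm_mulL u :
  rnorm (mulL g u) = \int[mu]_x (rnorm (g x) * rnorm (L1repr u x)).
Proof.
rewrite rnorm_cls; last exact: (bounded_byM bg (Kint_able_repr _)).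
by apply: eq_Rintegral => x _; rewrite rnormM.
Qed.

Lemma rnorm_pairing_mulL u : rnorm (pairing g u) <= rnorm (mulL g u).
Proof.
rewrite rnorm_cls; last exact: (bounded_byM bg (Kint_able_repr _)).
by apply: rnorm_Kint_le; exact: (bounded_byM bg (Kint_able_repr _)).
Qed.

Lemma rnorm_mulL_le u : rnorm (mulL g u) <= C * rnorm u.
Proof.
have ju := Kint_able_repr u.
rewrite rnorm_mulL (rnorm_L1 u) -RintegralZl//; last by case: ju.
apply: le_Rintegral => //.
- have [_] := bounded_byM bg ju.
  by rewrite (_ : (fun x => _) = (fun x => rnorm (g x) * rnorm (L1repr u x)))//;
    apply/funext => x; rewrite rnormM.
- by apply: rintegrableZ; case: ju.
- by move=> x _; rewrite ler_wpM2r ?rnorm_ge0//; case: bg.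
Qed.

Lemma rnorm_pairing_le u : rnorm (pairing g u) <= C * rnorm u.
Proof. exact: le_trans (rnorm_pairing_mulL u) (rnorm_mulL_le u). Qed.

End Fixed.

Lemma mulL_mulL C D g h u : bounded_by C g -> bounded_by D h ->
  mulL g (mulL h u) = mulL (fun x => g x * h x) u.
Proof.
move=> bg bh; rewrite [X in mulL g X]/mulL (mulL_cls bg).
  by congr cls; apply/funext => x; rewrite mulrA.
exact: (bounded_byM bh (Kint_able_repr _)).
Qed.

Lemma pairing_mulL C D g h u : bounded_by C g -> bounded_by D h ->
  pairing g (mulL h u) = pairing (fun x => g x * h x) u.
Proof.
move=> bg bh; rewrite /mulL (pairing_cls bg).
  by congr Kint; apply/funext => x; rewrite mulrA.
exact: (bounded_byM bh (Kint_able_repr _)).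
Qed.

Lemma mulLD C D g h u : bounded_by C g -> bounded_by D h ->
  mulL (fun x => g x + h x) u = mulL g u + mulL h u.
Proof.
move=> bg bh; rewrite /mulL -clsD; last 2 first.
- exact: (bounded_byM bg (Kint_able_repr _)).
- exact: (bounded_byM bh (Kint_able_repr _)).
by congr cls; apply/funext => x; rewrite mulrDl.
Qed.

Lemma mulL1 u : mulL (fun=> 1) u = u.
Proof.
by rewrite -[RHS]cls_repr; congr cls; apply/funext => x; rewrite mul1r.
Qed.

Lemma mulL0 u : mulL (fun=> 0) u = 0.
Proof.
rewrite -[RHS](scale0r (cls (fun=> 0))) -clsZ.
  by congr cls; apply/funext => x; rewrite !mul0r.
by apply: (@Kint_able_bounded _ _ _ _ _ _ 0) => [|x];
  [exact: Kmeasurable_cst|rewrite rnorm0].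
Qed.

End L1Layer.
Arguments cls {R s d Omega} mu f.

(** * Bochner integrals *)

Section SimpleFunctions.
Context {R : realType} {s : scalars} {d} {Omega : measurableType d}.
Context {mu : {finite_measure set Omega -> \bar R}}.
Local Notation K := (scalar_field R s).

Lemma of_real_gt0 (r : R) : 0 < r -> 0 < of_real r :> K.
Proof.
move=> r0; rewrite lt0r -(@of_real0 R s) le_of_real ?ltW// andbT.
by apply/eqP => /(congr1 repart); rewrite !repart_of_real; apply/eqP/lt0r_neq0.
Qed.

Lemma simple_preimage (V : normedModType K) (g : Omega -> V) (Y : set V) :
  simple_function g -> measurable (g @^-1` Y).
Proof.
move=> [fg mg].
rewrite (_ : g @^-1` Y = \bigcup_(v in range g `&` Y) g @^-1` [set v]).
  apply: fin_bigcup_measurable => //; exact: finite_setIl.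
apply/seteqP; split => [x Yx|x [v [_ Yv] /= ->]//].
by exists (g x) => //; split => //; exists x.
Qed.

(** Slicing along the finitely many values of g allows an arbitrary relation P, with no
    sigma-algebra on V or W. *)
Lemma simple_preimage2 (V W : normedModType K) (g : Omega -> V) (h : Omega -> W)
    (P : V -> W -> Prop) : simple_function g -> simple_function h ->
  measurable [set x | P (g x) (h x)].
Proof.
move=> sg sh.
rewrite (_ : [set x | _] = \bigcup_(v in range g)
   (g @^-1` [set v] `&` h @^-1` [set w | P v w])).
  apply: fin_bigcup_measurable => [|v _]; first by case: sg.
  by apply: measurableI; exact: simple_preimage.
apply/seteqP; split => [x Px|x [v _ [/= -> //]]].
by exists (g x) => //; exists x.
Qed.

Lemma Kint_indic (A : set Omega) : measurable A ->
  Kint mu (fun x => \1_A x : K) = of_real (fine (mu A)).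
Proof.
move=> mA; rewrite (_ : (fun x => _) = fun x => of_real (\1_A x) : K).
  rewrite Kint_of_real; last first.
    exact: integrable_indic.
  by congr (of_real (fine _)); rewrite integral_indic// setIT.
by apply/funext => x; exact: indic_of_real.
Qed.

Lemma Kint_able_indic (A : set Omega) : measurable A ->
  Kint_able mu (fun x => \1_A x : K).
Proof. move=> mA.
have [mi ib] : bounded_by 1 (fun x => \1_A x : K) by exact: bounded_by_indic.
exact: Kint_able_bounded mi ib. Qed.

Lemma simple_sum (V : normedModType K) (g : Omega -> V) (F : V -> K) x :
  simple_function g ->
  F (g x) = \sum_(v <- fset_set (range g)) F v * \1_(g @^-1` [set v]) x.
Proof.
move=> [fg _]; rewrite (big_fsetD1 (g x)) /=; last first.
  by rewrite in_fset_set// inE; exists x.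
rewrite indicE mem_set// mulr1 big_seq_cond big1 ?addr0// => v.
rewrite andbT !inE => /andP[vx _].
by rewrite indicE memNset ?mulr0// => /= /eqP; rewrite eq_sym (negPf vx).
Qed.

Lemma Kint_able_simple (V : normedModType K) (g : Omega -> V) (F : V -> K) :
  simple_function g -> Kint_able mu (fun x => F (g x)).
Proof.
move=> sg; rewrite (_ : (fun x => _) =
    fun x => \sum_(v <- fset_set (range g)) F v * \1_(g @^-1` [set v]) x).
  apply: Kint_able_sum => v; apply: Kint_ableZ; apply: Kint_able_indic.
  exact: simple_preimage.
by apply/funext => x; exact: simple_sum.
Qed.

Lemma Kint_simple (V : normedModType K) (g : Omega -> V) (F : V -> K) :
  simple_function g -> @linear_map R s V K F ->
  Kint mu (fun x => F (g x)) = F (simple_integral mu g).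
Proof.
move=> sg lF; rewrite (_ : (fun x => _) =
    fun x => \sum_(v <- fset_set (range g)) F v * \1_(g @^-1` [set v]) x).
  have mg v : measurable (g @^-1` [set v]) by exact: simple_preimage.
  rewrite Kint_sum; last by move=> v; exact/Kint_ableZ/Kint_able_indic.
  rewrite /simple_integral fsbig_finite; last by case: sg.
  rewrite /= (linear_sum_of _ _ _ lF); apply: eq_bigr => v _.
  rewrite KintZ; last exact: Kint_able_indic.
  by rewrite Kint_indic// (linearZ_of lF) mulrC.
by apply/funext => x; exact: simple_sum.
Qed.

Lemma norming (u : L1 s mu) :
  exists2 g, bounded_by 1 g & pairing g u = of_real (rnorm u).
Proof.
have [mu_ ju] := Kint_able_repr u.
exists (fun x => sgnK (L1repr u x)).
  by split => [|x]; [exact: Kmeasurable_sgnK|rewrite rnorm_sgnK].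
rewrite rnorm_L1 -Kint_of_real//; congr Kint.
by apply/funext => x; rewrite sgnKM.
Qed.

(** A pointwise bound on G - q v passes to the integrals. A functional g norming the difference
    reduces the claim to scalars, and it is applied to the simple approximants of G, for which
    integral and functional commute. *)
Lemma Bochner_integral_approx (G : Omega -> L1 s mu) (y v : L1 s mu)
    (q : Omega -> K) (r : Omega -> R) :
  is_Bochner_integral mu G y -> Kint_able mu q -> rintegrable mu r ->
  {ae mu, forall x, rnorm (G x - q x *: v) <= r x} ->
  rnorm (y - Kint mu q *: v) <= \int[mu]_x r x.
Proof.
move=> [_ [g_ [sg g_G g_y]]] jq ir [N [mN N0 GqrN]].
have [g bg gE] := norming (y - Kint mu q *: v).
have lg := pairing_linear (mu := mu) bg.
apply/ler_addgt0Pr => e e0; pose e2 := e / 2.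
have e20 : 0 < e2 by rewrite divr_gt0.
have [n [Gn yn]] : exists n, [/\
    (\int[mu]_x (rnorm (g_ n x - G x))%:E <= e2%:E)%E &
    rnorm (y - simple_integral mu (g_ n)) <= e2].
  have /fine_cvgP[fin /cvgrPdist_le/(_ _ e20) H1] := g_G.
  have /cvgrPdist_le/(_ _ (of_real_gt0 e20)) H2 := g_y.
  have [n [[f1 f2] f3]] := @filter_ex _ \oo _ _ (filterI (filterI fin H1) H2).
  exists n; split.
    rewrite -[leLHS]fineK// lee_fin; move: f2; rewrite sub0r normrN.
    by rewrite ger0_norm// fine_ge0// integral_ge0// => x _; rewrite lee_fin rnorm_ge0.
  by have := le_repart f3; rewrite repart_of_real.
pose F x := rnorm (pairing g (g_ n x) - q x * pairing g v).
have jF0 : Kint_able mu (fun x => pairing g (g_ n x) - pairing g v * q x).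
  apply: Kint_ableB; last exact: Kint_ableZ.
  exact: Kint_able_simple.
have FE : F = fun x => rnorm (pairing g (g_ n x) - pairing g v * q x).
  by apply/funext => x; rewrite /F mulrC.
have iF : rintegrable mu F by rewrite FE; case: jF0.
have mF := rintegrable_measurable iF.
(* The excess of F over r off the null set N. It is measurable and lies below the distance from
   [g_ n] to G, whose integral is at most e/2; hence F integrates to at most e/2 more than r. *)
pose w x := \1_(~` N) x * Num.max 0 (F x - r x).
have w0 x : 0 <= w x by rewrite mulr_ge0 ?le_max ?lexx// indicE; case: (_ \in _).
have wF x : `|w x| <= F x + `|r x|.
  rewrite (ger0_norm (w0 _)) /w indicE.
  have := ler_norm (r x); have := ler_norm (- r x); rewrite normrN.
  have : 0 <= F x by exact: rnorm_ge0.
  by case: (_ \in _) => /=; rewrite ?mul1r ?mul0r; [rewrite ge_max|]; lra.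
have iw : rintegrable mu w.
  apply: (rintegrable_dom _ (rintegrableD iF (rintegrable_norm ir)) wF).
  apply: measurable_funM; first by apply: measurable_indic; exact: measurableC.
  apply: measurable_maxr => //.
  by apply: measurable_funB => //; exact: rintegrable_measurable ir.
have wG : \int[mu]_x w x <= e2.
  rewrite -lee_fin fineK; last exact: integrable_fin_num.
  apply: le_trans Gn; apply: nn_le_integral => x; first by rewrite lee_fin.
  rewrite lee_fin /w indicE; case: (boolP (x \in _)) => /= xN; last first.
    by rewrite mul0r rnorm_ge0.
  rewrite mul1r ge_max rnorm_ge0 /= lerBlDr.
  have Gr : rnorm (G x - q x *: v) <= r x.
    by apply: contrapT => h; move/set_mem: xN; apply; exact: GqrN.
  apply: (@le_trans _ _ (rnorm (g_ n x - q x *: v))).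
    rewrite /F -[q x * _](linearZ_of lg) -(linearB_of lg).
    by have := rnorm_pairing_le bg (g_ n x - q x *: v); rewrite mul1r.
  by apply: le_trans (ler_rdist_add (G x) _ _) _; rewrite lerD2l.
have FI : \int[mu]_x F x <= e2 + \int[mu]_x r x.
  apply: (@le_trans _ _ (\int[mu]_x (w x + r x))).
    apply: le_Rintegral_ae => //; first exact: rintegrableD.
    exists N; split => // x /=; apply: contra_notP => xN.
    by rewrite /w indicE mem_set//= mul1r -lerBlDr le_max lexx orbT.
  by rewrite RintegralD// lerD2r.
have -> : rnorm (y - Kint mu q *: v) = rnorm (pairing g (y - Kint mu q *: v)).
  by rewrite gE rnorm_of_real ger0_norm// rnorm_ge0.
apply: le_trans (_ : e2 + (e2 + \int[mu]_x r x) <= _); last first.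
  by rewrite addrA addrC lerD2l /e2 -splitr.
rewrite -(subrK (simple_integral mu (g_ n)) y) -addrA (linearD_of lg).
apply: le_trans (rnormD _ _) _; apply: lerD.
  by have := rnorm_pairing_le bg (y - simple_integral mu (g_ n)); rewrite mul1r => /le_trans->.
apply: le_trans FI; rewrite (linearB_of lg) (linearZ_of lg) -Kint_simple//.
rewrite [Kint mu q *: _]mulrC -KintZ// -KintB//; last 2 first.
- exact: Kint_able_simple.
- exact: Kint_ableZ.
by rewrite FE; exact: rnorm_Kint_le.
Qed.

End SimpleFunctions.

(** * Local structure of representable operators *)

Section LocalApproximation.
Context {R : realType} {s : scalars} {d} {Omega : measurableType d}.
Context {mu : {finite_measure set Omega -> \bar R}}.
Local Notation K := (scalar_field R s).

Lemma rnorm_cvg (V : normedModType K) (v : nat -> V) (l : V) (e : R) : 0 < e ->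
  v n @[n --> \oo] --> l -> \forall n \near \oo, rnorm (l - v n) <= e.
Proof.
move=> e0 /cvgrPdist_le/(_ _ (of_real_gt0 e0)).
by apply: filterS => n /le_repart; rewrite repart_of_real.
Qed.

(** An argument of Egorov type. The set where all later approximants stay within dlt of the n-th one
    involves only simple functions, hence is measurable; almost every point belongs to it for large
    n, and the estimate for H follows in the limit. *)
Lemma strongly_measurable_approx (V : normedModType K) (H : Omega -> V)
    (F : Omega -> R) (dlt e : R) : strongly_measurable mu H ->
  rintegrable mu F -> 0 < dlt -> 0 < e ->
  exists (g : Omega -> V) (D : set Omega), [/\ simple_function g, measurable D,
    {ae mu, forall x, D x -> rnorm (H x - g x) <= dlt} &
    `|\int[mu]_x (\1_(~` D) x * F x)| <= e].
Proof.
move=> [h [sh hH]] iF dlt0 e0.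
pose D n := \bigcap_m [set x | (n <= m)%N -> rnorm (h m x - h n x) <= dlt].
have mD n : measurable (D n).
  apply: bigcap_measurable => [|m _]; first by exists 0%N.
  exact: (simple_preimage2 (fun v w => (n <= m)%N -> rnorm (v - w) <= dlt)).
have d20 : 0 < dlt / 2 by rewrite divr_gt0.
have evD : {ae mu, forall x, \forall n \near \oo, ~ (~` D n) x}.
  apply: filterS hH => x /(rnorm_cvg d20) [N _ HN].
  exists N => // n /= Nn; rewrite notK => m _ /= nm.
  rewrite (le_trans (ler_rdist_add (H x) _ _))// (splitr dlt) lerD//.
    by rewrite rdistC HN//= (leq_trans Nn).
  exact: HN.
have /cvgrPdist_le/(_ _ e0) [N _ /(_ N (leqnn N)) /= HN] :=
  cvg_Rintegral_indic0 iF (fun n => measurableC (mD n)) evD.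
exists (h N), (D N); split => //; last by rewrite sub0r normrN in HN.
apply: filterS hH => x hx DNx; apply/ler_addgt0Pr => r r0.
have [M _ HM] := rnorm_cvg r0 hx.
rewrite (le_trans (ler_rdist_add (h (maxn M N) x) _ _))// addrC lerD//.
  by apply: DNx => //=; exact: leq_maxr.
by apply: HM => /=; exact: leq_maxl.
Qed.

Lemma measure_bigcup_gt0 (F : nat -> set Omega) (A : set Omega) :
  (forall n, measurable (F n)) -> measurable A -> A `<=` \bigcup_n F n ->
  (0 < mu A)%E -> exists n, (0 < mu (F n))%E.
Proof.
move=> mF mA AF A0; apply: contrapT => nF.
have F0 n : mu.-negligible (F n).
  apply/negligibleP => //; apply/eqP; rewrite eq_le measure_ge0 andbT leNgt.
  by apply/negP => h; apply: nF; exists n.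
have : mu.-negligible A by apply: negligibleS AF _; exact: negligible_bigcup.
by move/negligibleP => /(_ mA) A00; move: A0; rewrite A00 ltxx.
Qed.

Lemma near_constant_real (F : Omega -> R) (A : set Omega) (e : R) :
  measurable_fun setT F -> measurable A -> (0 < mu A)%E -> 0 < e ->
  exists (E : set Omega) (c : R), [/\ measurable E, E `<=` A, (0 < mu E)%E &
    forall x, E x -> `|F x - c| <= e].
Proof.
move=> mF mA A0 e0.
(* An enumeration of the grid of integer multiples of e; indices that code no integer repeat the
   point 0. Each value of F lies within e of the grid, so one of the countably many cells has
   positive measure in A. *)
pose c n : R := (odflt 0 (choice.unpickle n : option int))%:~R * e.
pose E n := A `&` [set x | `|F x - c n| <= e].
have mE n : measurable (E n).
  apply: measurableI => //; rewrite -[X in measurable X]setTI.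
  apply: measurable_fun_le => //.
  by apply: measurableT_comp => //; apply: measurable_funB.
have AE : A `<=` \bigcup_n E n.
  move=> x Ax; exists (choice.pickle (Num.floor (F x / e))) => //; split => //=.
  rewrite /c choice.pickleK /=.
  have /andP[h1 h2] := floor_itv (F x / e).
  move: h1 h2; rewrite ler_pdivlMr// ltr_pdivrMr// intrD mulrDl mul1r => h1 h2.
  by rewrite ler_norml; lra.
have [n En] := measure_bigcup_gt0 mE mA AE A0.
by exists (E n), (c n); split => // x [].
Qed.

Lemma rnorm_sub_mkK (x : K) (a b : R) :
  rnorm (x - mkK a b) <= `|repart x - a| + `|impart x - b|.
Proof.
apply: le_trans (rnorm_le_parts _) _; rewrite repartB repart_mkK lerD2l.
move: x; rewrite /mkK /impart; case: s => [x|[? ?]]//.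
by rewrite normr0.
Qed.

Lemma near_constant (f : Omega -> K) (A : set Omega) (e : R) :
  Kmeasurable f -> measurable A -> (0 < mu A)%E -> 0 < e ->
  exists (E : set Omega) (c : K), [/\ measurable E, E `<=` A, (0 < mu E)%E &
    forall x, E x -> rnorm (f x - c) <= e].
Proof.
move=> [fr fi] mA A0 e0; have e20 : 0 < e / 2 by rewrite divr_gt0.
have [E [a [mE EA E0 Ea]]] := near_constant_real fr mA A0 e20.
have [E' [b [mE' EE' E'0 E'b]]] := near_constant_real fi mE E0 e20.
exists E', (mkK a b); split => // [x /EE'/EA//|x E'x].
rewrite (le_trans (rnorm_sub_mkK _ _ _))// (splitr e) lerD//.
  exact/Ea/EE'.
exact: E'b.
Qed.

(** * Finite unions of disjoint pieces *)

Section IndicatorSums.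
Variables (I : choiceType) (t : seq I) (P : pred I) (A : I -> set Omega).
Hypothesis ut : uniq t.
Hypothesis dA : forall i j x, A i x -> A j x -> i = j.

Definition union_of : set Omega := [set x | exists i, [/\ i \in t, P i & A i x]].

Lemma indic_union_of (T : pzRingType) x :
  \1_union_of x = \sum_(i <- t | P i) \1_(A i) x :> T.
Proof.
rewrite indicE; have [[i [it Pi Aix]]|nU] := pselect (union_of x).
  rewrite mem_set; last by exists i.
  rewrite big_mkcond (bigD1_seq i)//= Pi indicE mem_set// big1 ?addr0// => j ji.
  case: ifP => // _; rewrite indicE memNset// => Ajx.
  by move/eqP: ji; apply; exact: dA Ajx Aix.
rewrite memNset// big_seq_cond big1// => i /andP[it Pi].
by rewrite indicE memNset// => Aix; apply: nU; exists i.
Qed.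

Hypothesis mA : forall i, measurable (A i).

Lemma measurable_union_of : measurable union_of.
Proof.
rewrite (_ : union_of = \big[setU/set0]_(i <- t | P i) A i).
  exact: bigsetU_measurable.
rewrite -bigcup_seq_cond; apply/seteqP; split => x.
  by move=> [i [it Pi Aix]]; exists i => //=; rewrite it Pi.
by move=> [i /= /andP[it Pi] Aix]; exists i.
Qed.

Lemma mulL_union_of (u : L1 s mu) :
  mulL (\1_union_of) u = \sum_(i <- t | P i) mulL (\1_(A i)) u.
Proof.
have ju := Kint_able_repr u.
have bA i : bounded_by 1 (fun x => \1_(A i) x : K) by exact: bounded_by_indic.
rewrite (_ : mulL \1_union_of u =
    cls mu (fun x => \sum_(i <- t | P i) \1_(A i) x * L1repr u x)); last first.
  by congr cls; apply/funext => x; rewrite indic_union_of mulr_suml.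
elim: (t) => [|i t' IH].
  rewrite big_nil -[RHS](mulL0 u); congr cls; apply/funext => x.
  by rewrite big_nil mul0r.
rewrite big_cons -IH; case: ifPn => Pi.
  rewrite -clsD.
  - by congr cls; apply/funext => x; rewrite big_cons Pi.
  - exact: (bounded_byM (bA i) ju).
  - by apply: Kint_able_sum => j; exact: (bounded_byM (bA j) ju).
by congr cls; apply/funext => x; rewrite big_cons (negPf Pi).
Qed.

End IndicatorSums.

Lemma rnorm_indic (A : set Omega) x : rnorm (\1_A x : K) = \1_A x.
Proof. by rewrite !indicE; case: (_ \in _); rewrite ?rnorm0 ?rnorm1. Qed.

Lemma rintegrable_indicM (A : set Omega) (F : Omega -> R) : measurable A ->
  rintegrable mu F -> rintegrable mu (fun x => \1_A x * F x).
Proof.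
move=> mA iF; apply: rintegrable_dom (rintegrable_norm iF) _.
  apply: measurable_funM; first exact: measurable_indic.
  exact: rintegrable_measurable iF.
by move=> x; rewrite normrM ler_piMl// indicE; case: (_ \in _);
  rewrite ?normr0 ?normr1.
Qed.

Lemma rnorm_mulL_indic (A : set Omega) (u : L1 s mu) : measurable A ->
  rnorm (mulL \1_A u) = \int[mu]_x (\1_A x * rnorm (L1repr u x)).
Proof.
move=> mA; rewrite (rnorm_mulL (bounded_by_indic mA)).
by apply: eq_Rintegral => x _; rewrite rnorm_indic.
Qed.

(** Additivity of the L_1 norm over disjoint sets: an estimate that holds on each piece with one
    constant holds on the union with the same constant. *)
Lemma rnorm_mulL_union_of (I : choiceType) (t : seq I) (P : pred I)
    (A : I -> set Omega) (u : L1 s mu) : uniq t ->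
  (forall i j x, A i x -> A j x -> i = j) -> (forall i, measurable (A i)) ->
  rnorm (mulL \1_(union_of t P A) u) = \sum_(i <- t | P i) rnorm (mulL \1_(A i) u).
Proof.
move=> ut dA mA; have [_ ju] := Kint_able_repr u.
rewrite rnorm_mulL_indic; last exact: measurable_union_of.
under eq_Rintegral => x _ do rewrite indic_union_of// mulr_suml.
under eq_bigr => i _ do rewrite rnorm_mulL_indic//.
have ii i := rintegrable_indicM (mA i) ju.
have isum t' : rintegrable mu
    (fun x => \sum_(i <- t' | P i) \1_(A i) x * rnorm (L1repr u x)).
  elim: t' => [|i t' IH].
    rewrite (_ : (fun x => _) = fun=> 0); first exact: rintegrable_cst.
    by apply/funext => x; rewrite big_nil.
  case: (boolP (P i)) => Pi.
    rewrite (_ : (fun x => _) = fun x => \1_(A i) x * rnorm (L1repr u x) +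
       \sum_(i <- t' | P i) \1_(A i) x * rnorm (L1repr u x)).
      exact: rintegrableD.
    by apply/funext => x; rewrite big_cons Pi.
  rewrite (_ : (fun x => _) = fun x =>
       \sum_(i <- t' | P i) \1_(A i) x * rnorm (L1repr u x))//.
  by apply/funext => x; rewrite big_cons (negPf Pi).
elim: (t) => [|i t' IH].
  by rewrite big_nil; under eq_Rintegral => x _ do rewrite big_nil;
    rewrite Rintegral_cst// mul0r.
rewrite big_cons -IH; case: ifPn => Pi.
  rewrite -RintegralD//; [|exact: ii|exact: isum].
  by apply: eq_Rintegral => x _; rewrite big_cons Pi.
by apply: eq_Rintegral => x _; rewrite big_cons (negPf Pi).
Qed.

Lemma mulL_indicC (A : set Omega) (u : L1 s mu) : measurable A ->
  mulL \1_(~` A) u + mulL \1_A u = u.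
Proof.
move=> mA; rewrite -(mulLD u (bounded_by_indic (measurableC mA)) (bounded_by_indic mA)).
rewrite -[RHS]mulL1; congr mulL; apply/funext => x.
by rewrite !indicE in_setC; case: (_ \in _); rewrite ?addr0 ?add0r.
Qed.

Lemma rnorm_mulL_indicC (A : set Omega) (u : L1 s mu) : measurable A ->
  rnorm (mulL \1_(~` A) u) + rnorm (mulL \1_A u) = rnorm u.
Proof.
move=> mA; have [_ ju] := Kint_able_repr u; have mAc := measurableC mA.
rewrite !rnorm_mulL_indic// -RintegralD//; try exact: rintegrable_indicM.
rewrite rnorm_L1; apply: eq_Rintegral => x _.
by rewrite !indicE in_setC; case: (_ \in _); rewrite !(mul1r, mul0r) ?addr0 ?add0r.
Qed.

(* The operator is nearly the rank-one map u |-> (pairing g u) v on each piece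
   of a finite partition: the approximants of conj(g) h are simple functions,
   and h - g v = g (conj(g) h - v) where |g| = 1. *)
Lemma representable_local (S : L1 s mu -> L1 s mu) (g : Omega -> K)
    (F : Omega -> R) (dlt e : R) : representable S -> bounded_by 1 g ->
  rintegrable mu F -> (forall x, 0 <= F x) -> 0 < dlt -> 0 < e ->
  exists (t : seq (L1 s mu)) (A : L1 s mu -> set Omega), [/\ uniq t,
    forall v w x, A v x -> A w x -> v = w, forall v, measurable (A v) &
    [/\ forall v x, A v x -> rnorm (g x) = 1,
    \int[mu]_x (\1_([set x | rnorm (g x) = 1] `\` union_of t predT A) x * F x)
      <= e &
    forall v u, rnorm (S (mulL \1_(A v) u) - pairing g (mulL \1_(A v) u) *: v)
      <= dlt * rnorm (mulL \1_(A v) u)]].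
Proof.
move=> [bS [h [_ _ Bh]]] bg iF F0 dlt0 e0.
have [mg g1] := bg.
have jcg : (fun x => conjK (g x)) \in Kintegrable mu.
  apply/Kint_ableP; apply: (Kint_able_bounded (Kmeasurable_conjK mg)) => x.
  by rewrite rnorm_conjK; exact: g1.
(* Strong measurability of conj(g) h is part of its Bochner integrability, obtained by applying the
   representation to conj(g), which is bounded and therefore integrable. *)
have [sm _] := Bh (IntegrableFun jcg).
have [sg [D [ssg mD HD FD]]] := strongly_measurable_approx sm iF dlt0 e0.
pose G := [set x | rnorm (g x) = 1].
have mG : measurable G by exact: measurable_rnorm_eq.
(* A piece is indexed by its own rank-one vector v, the value of the simple function on it; for v
   outside the range the piece is empty, so the estimates hold for every v. *)
pose A v := D `&` G `&` sg @^-1` [set v].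
have mA v : measurable (A v).
  by apply: measurableI; [exact: measurableI|exact: simple_preimage].
exists (fset_set (range sg)), A; split => //; first exact: fset_uniq.
  by move=> v w x [_ /= <-] [_ /= <-].
split; first by move=> v x [[]].
  apply: le_trans FD; rewrite ger0_norm; last first.
    by apply: Rintegral_ge0 => x _; rewrite mulr_ge0.
  have mU : measurable (G `\` union_of (fset_set (range sg)) predT A).
    apply: measurableD => //; exact: measurable_union_of.
  apply: le_Rintegral => //; try exact: rintegrable_indicM.
    by apply: rintegrable_indicM => //; exact: measurableC.
  move=> x _; apply: ler_wpM2r => //; rewrite indicE.
  have [/set_mem[Gx nU]|_] := boolP (x \in _); last by rewrite indicE.
  rewrite indicE mem_set// => Dx; apply: nU; exists (sg x); split => //.
  by rewrite in_fset_set; [rewrite inE; exists x|case: ssg].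
move=> v u; set w := mulL _ u.
have ju := Kint_able_repr u.
have bA : bounded_by 1 (fun x => \1_(A v) x : K) by exact: bounded_by_indic.
have jw := bounded_byM bA ju.
have -> : w = cls mu (fun x => \1_(A v) x * L1repr u x) by [].
rewrite (pairing_cls bg)// rnorm_cls//.
have /Kint_ableP jw' := jw.
rewrite (clsE jw') -RintegralZl//; last by case: jw.
apply: Bochner_integral_approx (Bh (IntegrableFun jw')) _ _ _.
- exact: (bounded_byM bg jw).
- by apply: rintegrableZ; case: jw.
apply: filterS HD => x HDx /=.
set a := \1_(A v) x * _.
rewrite [g x * a]mulrC -[(a * g x) *: v]scalerA -scalerBr rnormZ mulrC.
case: (boolP (x \in A v)) => [/set_mem[[Dx Gx] /= sgx]|xA]; last first.
  by rewrite /a indicE (negPf xA) mul0r rnorm0 !mulr0.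
rewrite ler_wpM2r ?rnorm_ge0//.
rewrite -[leLHS]mul1r -{1}Gx -rnorm_conjK -rnormZ scalerBr scalerA.
by rewrite conjK_unimodular// scale1r -sgx; exact: HDx.
Qed.

End LocalApproximation.

(** * The numerical radius of a representable operator is its norm *)

Section NormFromNumericalRadius.
Context {R : realType} {s : scalars} {d} {Omega : measurableType d}.
Context {mu : {finite_measure set Omega -> \bar R}}.
Local Notation K := (scalar_field R s).

Definition normalized_indic (E : set Omega) : L1 s mu :=
  cls mu (fun x => of_real (fine (mu E))^-1 * \1_E x).

Section NormalizedIndicator.
Variable E : set Omega.
Hypotheses (mE : measurable E) (E0 : (0 < mu E)%E).

Lemma fine_mu_gt0 : 0 < fine (mu E).
Proof. by apply: fine_gt0; rewrite E0 ltey_eq fin_num_measure. Qed.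

Lemma Kint_able_normalized_indic :
  Kint_able mu (fun x => of_real (fine (mu E))^-1 * \1_E x : K).
Proof. exact/Kint_ableZ/Kint_able_indic. Qed.

Lemma rnorm_normalized_indic : rnorm (normalized_indic E) = 1.
Proof.
rewrite rnorm_cls; last exact: Kint_able_normalized_indic.
under eq_Rintegral => x _ do rewrite rnormM rnorm_indic rnorm_of_real.
rewrite ger0_norm ?invr_ge0 ?ltW ?fine_mu_gt0// RintegralZl//; last first.
  exact: integrable_indic.
have -> : \int[mu]_x \1_E x = fine (mu E).
  by rewrite /Rintegral integral_indic// setIT.
by rewrite mulVf// gt_eqF// fine_mu_gt0.
Qed.

Lemma pairing_normalized_indic (C : R) (g : Omega -> K) : bounded_by C g ->
  (forall x, E x -> g x = 1) -> pairing g (normalized_indic E) = 1.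
Proof.
move=> bg gE; rewrite (pairing_cls bg); last exact: Kint_able_normalized_indic.
rewrite (_ : (fun x => _) = fun x => of_real (fine (mu E))^-1 * \1_E x).
  rewrite KintZ; last exact: Kint_able_indic.
  by rewrite Kint_indic// -of_realM mulVf ?of_real1// gt_eqF// fine_mu_gt0.
apply/funext => x; rewrite indicE; case: (boolP (x \in E)) => [/set_mem/gE ->|_].
  by rewrite mul1r.
by rewrite !mulr0.
Qed.

Lemma mulL_normalized_indic (A : set Omega) : measurable A -> E `<=` A ->
  mulL \1_A (normalized_indic E) = normalized_indic E.
Proof.
move=> mA EA; rewrite (mulL_cls (bounded_by_indic mA)); last first.
  exact: Kint_able_normalized_indic.
congr cls; apply/funext => x; rewrite mulrCA; congr (_ * _).
rewrite !indicE; case: (boolP (x \in E)) => [/set_mem/EA Ax|_]; last by rewrite mulr0.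
by rewrite mem_set// mulr1.
Qed.

End NormalizedIndicator.

(* On a set E of positive measure where v is nearly a constant c, test against
   g = 1 on E and g = (phase of c) * conj(phase of v) off E: then
   |int g v| is nearly |v|, while g(1_E / mu E) = 1. *)
Lemma almost_norming (v : L1 s mu) (A : set Omega) (e : R) : measurable A ->
  (0 < mu A)%E -> 0 < e ->
  exists (E : set Omega) (g : Omega -> K), [/\ measurable E, E `<=` A,
    (0 < mu E)%E & [/\ bounded_by 1 g, forall x, E x -> g x = 1 &
    rnorm v <= rnorm (pairing g v) + e]].
Proof.
move=> mA A0 e0; have [mv jv] := Kint_able_repr v.
pose M := fine (mu setT).
have M0 : 0 <= M by rewrite fine_ge0.
(* The two integrands compared below differ by at most 2 e2 at each point, and the total mass is
   M. *)
pose e2 := e / (2 * (M + 1)).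
have M1 : 0 < 2 * (M + 1) by rewrite mulr_gt0// ltr_wpDl.
have e20 : 0 < e2 by rewrite divr_gt0.
have [E [c [mE EA E0 Ec]]] := near_constant mv mA A0 e20.
pose w := conjK (sgnK c).
have w1 : rnorm w = 1 by rewrite rnorm_conjK rnorm_sgnK.
have cE : c = w * of_real (rnorm c).
  by rewrite -sgnKM mulrA conjK_unimodular ?mul1r// rnorm_sgnK.
pose g x := if x \in E then 1 else w * sgnK (L1repr v x).
have mg : Kmeasurable g.
  apply: Kmeasurable_if => //; first exact: Kmeasurable_cst.
  exact/KmeasurableZ/Kmeasurable_sgnK.
have bg : bounded_by 1 g.
  split => // x; rewrite /g; case: ifP => _; first by rewrite rnorm1.
  by rewrite rnormM w1 rnorm_sgnK mul1r.
exists E, g; split => //; split => //; first by move=> x Ex; rewrite /g mem_set.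
have jgv := bounded_byM bg (Kint_able_repr v).
have jav : Kint_able mu (fun x => w * of_real (rnorm (L1repr v x))).
  apply: Kint_ableZ; apply: (Kint_able_dom _ jv).
    exact/Kmeasurable_of_real/Kmeasurable_norm.
  by move=> x; rewrite rnorm_of_real ger0_norm// rnorm_ge0.
have -> : rnorm v = rnorm (Kint mu (fun x => w * of_real (rnorm (L1repr v x)))).
  rewrite KintZ; last first.
    apply: (Kint_able_dom _ jv); first exact/Kmeasurable_of_real/Kmeasurable_norm.
    by move=> x; rewrite rnorm_of_real ger0_norm// rnorm_ge0.
  by rewrite Kint_of_real// rnormM w1 mul1r -rnorm_L1 rnorm_of_real ger0_norm ?rnorm_ge0.
rewrite -lerBlDl (le_trans (ler_rnormB _ _))// -KintB//.
have jB := Kint_ableB jav jgv.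
apply: le_trans (rnorm_Kint_le jB) _.
apply: (@le_trans _ _ (\int[mu]_(x in setT) (2 * e2))).
  apply: le_Rintegral => //; [by case: jB|exact: rintegrable_cst|].
  move=> x _; rewrite /g; case: ifPn => [/set_mem Ex|_]; last first.
    by rewrite -mulrA sgnKM subrr rnorm0 mulr_ge0// ltW.
  (* On E both w|v| and v are within e2 of c: since c = w|c|, the first distance is the difference
     of the moduli of v and c. Off E the integrands coincide. *)
  rewrite mul1r; apply: le_trans (ler_rdist_add c _ _) _.
  rewrite mulr_natl mulr2n; apply: lerD; last by rewrite rdistC; exact: Ec.
  rewrite {1}cE -mulrBr rnormM w1 mul1r -of_realB rnorm_of_real.
  apply: le_trans (Ec _ Ex).
  by rewrite ler_norml lerNl opprB ler_rnormB {1}rdistC ler_rnormB.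
rewrite Rintegral_cst// -/M /e2.
rewrite (_ : 2 * _ * M = e * (M / (M + 1))).
  by rewrite -[leRHS]mulr1 ler_wpM2l ?(ltW e0)// ler_pdivrMr ?mul1r ?lerDl// ltr_wpDl.
by field; rewrite gt_eqF// ltr_wpDl.
Qed.

(** With density 1 in [representable_local], S(u 1_A) is close to (int u 1_A) v on each piece, so it
    suffices to bound |v|. A normalised indicator inside the piece is sent near v and forms a
    norming pair with an almost norming functional of v, so the numerical radius controls |v|. *)
Lemma le_numerical_radius (S : L1 s mu -> L1 s mu) : representable S ->
  numerical_radius S <= 1 -> forall u, rnorm (S u) <= rnorm u.
Proof.
move=> rS nS u; have [bS _] := rS; have [lS [C SC]] := bS.
have [_ ju] := Kint_able_repr u.
have b1 : bounded_by 1 (fun _ : Omega => 1 : K).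
  by split => [|x]; [exact: Kmeasurable_cst|rewrite rnorm1].
(* The total error is |C| e from the uncovered part plus 4 e |u| from the pieces; the summand 1
   keeps B positive. *)
pose B := `|C| + 4 * rnorm u + 1.
have B0 : 0 < B by rewrite ltr_wpDl// addr_ge0// mulr_ge0// rnorm_ge0.
apply/ler_addgt0Pr => e' e'0; pose e := e' / B.
have e0 : 0 < e by rewrite divr_gt0.
have [t [A [ut dA mA [_ FA HA]]]] :=
  representable_local rS b1 ju (fun x => rnorm_ge0 _) e0 e0.
pose U := union_of t predT A.
have mU : measurable U by exact: measurable_union_of.
have nU : rnorm (mulL \1_(~` U) u) <= e.
  rewrite rnorm_mulL_indic; last exact: measurableC.
  apply: le_trans FA; rewrite (_ : [set x | _] `\` _ = ~` U)//.
  by apply/seteqP; split => [x []//|x Ux]; split => //=; rewrite rnorm1.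
have Hv v : rnorm (S (mulL \1_(A v) u)) <= (1 + 4 * e) * rnorm (mulL \1_(A v) u).
  have : ((0 : \bar R) <= mu (A v))%E by [].
  (* A null piece carries no normalised indicator to test with, but every class vanishes on it. *)
  rewrite le_eqVlt => /orP[/eqP A0|A0].
    suff -> : mulL \1_(A v) u = 0 by rewrite (linear0_of lS) !rnorm0 mulr0.
    apply: rnorm_eq0; apply/le_anti; rewrite rnorm_ge0 andbT rnorm_mulL_indic//.
    rewrite (@eq_Rintegral_ae _ _ _ _ _ (fun=> 0)) ?Rintegral_cst ?mul0r//.
      exact/rintegrable_measurable/(rintegrable_indicM (mA v) ju).
    exists (A v); split => // x /=; apply: contra_notP => nA.
    by rewrite indicE memNset// mul0r.
  (* One e is lost in almost norming v and one in replacing v by S w; the third is slack. *)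
  have v1 : rnorm v <= 1 + 3 * e.
    have [E [g [mE EA E0 [bg gE Hg]]]] := almost_norming v (mA v) A0 e0.
    pose w := normalized_indic E.
    have w1 : rnorm w = 1 by exact: rnorm_normalized_indic.
    have gw : pairing g w = 1 by exact: pairing_normalized_indic bg gE.
    have pg (u' : L1 s mu) : rnorm (pairing g u') <= rnorm u'.
      by have := rnorm_pairing_le bg u'; rewrite mul1r.
    have dg := dual_sphere_of (pairing_linear (mu := mu) bg) pg w1 gw.
    have := numerical_radius_ge bS w1 dg gw.
    have := HA v w; rewrite mulL_normalized_indic// -/w w1 mulr1.
    rewrite (pairing_normalized_indic mE E0 b1)// scale1r => H1 H2.
    have H3 := le_trans (pg (S w - v)) H1.
    have H4 : rnorm (pairing g v) - rnorm (pairing g (S w)) <= e.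
      apply: le_trans (ler_rnormB _ _) _.
      by rewrite rdistC -(linearB_of (pairing_linear (mu := mu) bg)).
    have H5 := le_trans H2 nS; apply: le_trans Hg _.
    move: (rnorm (pairing g v)) (rnorm (pairing g (S w))) H4 H5 => a b H4 H5.
    by clear -H4 H5 e0; lra.
  have := ler_rnormB (S (mulL \1_(A v) u)) (pairing (fun=> 1) (mulL \1_(A v) u) *: v).
  have := HA v u; rewrite rnormZ.
  have := rnorm_pairing_le b1 (mulL \1_(A v) u); rewrite mul1r.
  have := rnorm_ge0 (mulL \1_(A v) u); have := rnorm_ge0 v.
  have := rnorm_ge0 (pairing (fun=> 1) (mulL \1_(A v) u)).
  set p := rnorm (pairing _ _); set n := rnorm (mulL _ _).
  move=> p0 v0 n0 pn H1 H2; have := ler_pM p0 v0 pn v1.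
  by move: H1 H2; rewrite -/p; lra.
rewrite -{1}(mulL_indicC u mU) (linearD_of lS).
rewrite (mulL_union_of _ ut)// (linear_sum_of _ _ _ lS).
have H1 : rnorm (S (mulL \1_(~` U) u)) <= `|C| * e.
  apply: le_trans (SC _) _; apply: (@le_trans _ _ (`|C| * rnorm (mulL \1_(~` U) u))).
    by rewrite ler_wpM2r ?rnorm_ge0// ler_norm.
  by rewrite ler_wpM2l.
have H2 : rnorm (\sum_(v <- t) S (mulL \1_(A v) u)) <= (1 + 4 * e) * rnorm u.
  apply: le_trans (rnorm_sum _ _ _) _.
  apply: (@le_trans _ _ (\sum_(v <- t) (1 + 4 * e) * rnorm (mulL \1_(A v) u))).
    exact: ler_sum.
  rewrite -mulr_sumr -rnorm_mulL_union_of//.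
  apply: ler_wpM2l; first by rewrite addr_ge0// mulr_ge0// ltW.
  by rewrite -[leRHS](rnorm_mulL_indicC u mU) lerDr rnorm_ge0.
apply: le_trans (rnormD _ _) _.
apply: le_trans (lerD H1 H2) _.
rewrite (_ : e' = B * e); last by rewrite mulrC divfK// gt_eqF.
by rewrite /B; move: (ltW e0); lra.
Qed.

End NormFromNumericalRadius.

(** * Functionals on $L_1$ *)

Section RealFunctionalDensity.
Context {R : realType} {s : scalars} {d} {Omega : measurableType d}.
Context {mu : {finite_measure set Omega -> \bar R}}.
Local Notation K := (scalar_field R s).
Variable P : L1 s mu -> R.
Hypothesis PD : {morph P : u v / u + v}.
Hypothesis P1 : forall u, `|P u| <= rnorm u.

Lemma mulL_cls_indic (A B : set Omega) : measurable A -> measurable B ->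
  mulL \1_A (cls mu \1_B) = cls mu \1_(A `&` B) :> L1 s mu.
Proof.
move=> mA mB; rewrite (mulL_cls (bounded_by_indic mA)).
  by congr cls; apply/funext => x; rewrite indicI.
exact: Kint_able_indic.
Qed.

Lemma cls_indic_mulL (A : set Omega) : measurable A ->
  cls mu \1_A = mulL \1_A (cls mu \1_setT) :> L1 s mu.
Proof. by move=> mA; rewrite mulL_cls_indic// setIT. Qed.

(** P is real and additive, so that the real and the imaginary part of a scalar functional both
    qualify. *)
Definition charge_of_functional (A : set Omega) : \bar R := (P (cls mu \1_A))%:E.

Local Notation nu := charge_of_functional.

Let P0 : P 0 = 0.
Proof. by apply/eqP; rewrite -normr_le0 -(@rnorm0 R s (L1 s mu)). Qed.

Let nu0 : nu set0 = 0%E.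
Proof.
rewrite /nu (_ : cls mu \1_set0 = 0) ?P0// cls_indic_mulL//.
rewrite -[RHS](mulL0 (cls mu \1_setT)); congr mulL; apply/funext => x.
by rewrite indic0.
Qed.

Let nu_fin A : measurable A -> nu A \is a fin_num.
Proof. by []. Qed.

Lemma rnorm_cls_indic (A : set Omega) : measurable A ->
  rnorm (cls mu \1_A : L1 s mu) = fine (mu A).
Proof.
move=> mA; rewrite rnorm_cls; last exact: Kint_able_indic.
under eq_Rintegral => x _ do rewrite rnorm_indic.
by rewrite /Rintegral integral_indic// setIT.
Qed.

(** The error after n terms is P at the indicator of the tail D n, hence at most its measure, which
    tends to 0 because each point leaves the tails. *)
Let nu_sigma_additive : semi_sigma_additive nu.
Proof.
move=> F mF tF mUF.
pose U n := union_of (index_iota 0 n) predT F.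
have dF i j x : F i x -> F j x -> i = j.
  move=> Fi Fj; apply: contrapT => /eqP ij.
  move/trivIsetP: tF => /(_ i j I I ij) FF.
  by have : (F i `&` F j) x by []; rewrite FF.
have mU n : measurable (U n) by exact: measurable_union_of.
pose D n := \bigcup_n F n `\` U n.
have mD n : measurable (D n) by exact: measurableD.
have UE n : (\sum_(0 <= i < n) nu (F i) = (P (cls mu \1_(U n)))%:E)%E.
  rewrite cls_indic_mulL// mulL_union_of ?iota_uniq// (big_morph P PD P0).
  by rewrite -sumEFin; apply: eq_bigr => i _; rewrite -cls_indic_mulL.
have DE n : P (cls mu \1_(\bigcup_n F n)) - P (cls mu \1_(U n)) = P (cls mu \1_(D n)).
  apply/eqP; rewrite subr_eq; apply/eqP.
  rewrite -PD; congr P; rewrite -clsD; try exact: Kint_able_indic.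
  congr cls; apply/funext => x; rewrite !indicE.
  have [Ux|nUx] := pselect (U n x).
    rewrite [in X in _ + X]mem_set// mem_set; last first.
      by have [i [_ _ Fx]] := Ux; exists i.
    by rewrite memNset ?add0r// => -[].
  rewrite [in X in _ + X]memNset// addr0; congr (_%:R : K).
  have [Fx|nFx] := pselect ((\bigcup_n F n) x).
    by rewrite !mem_set.
  by rewrite !memNset// => -[].
apply: (@cvg_trans _ ((fun n => (P (cls mu \1_(U n)))%:E) @ \oo)).
  by apply: near_eq_cvg; apply: nearW => n; rewrite UE.
apply: cvg_EFin; first exact: nearW.
apply/cvgrPdist_le => e e0.
have H : {ae mu, forall x, \forall n \near \oo, ~ D n x}.
  apply: aeW => x; have [[i _ Fx]|nFx] := pselect ((\bigcup_n F n) x).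
    exists i.+1 => // n /= i_n [_]; apply; exists i; split => //.
    by rewrite mem_index_iota.
  by apply: nearW => n [].
have /cvgrPdist_le/(_ _ e0) := cvg_Rintegral_indic0 (rintegrable_cst 1) mD H.
apply: filterS => n; rewrite sub0r normrN => He.
rewrite DE; apply: le_trans (P1 _) _; apply: le_trans He.
rewrite rnorm_cls; last exact: Kint_able_indic.
rewrite ger0_norm; last by apply: Rintegral_ge0 => x _; rewrite mulr1.
by under eq_Rintegral => x _ do rewrite rnorm_indic -[\1_(D n) x]mulr1.
Qed.

HB.instance Definition _ := isCharge.Build _ Omega R nu
  nu0 nu_fin nu_sigma_additive.

(** Radon-Nikodym for the charge, which is absolutely continuous because its value at A is bounded
    by the measure of A. *)
Lemma functional_density : exists2 F : Omega -> R, rintegrable mu F &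
  forall A, measurable A -> P (cls mu \1_A) = \int[mu]_x (\1_A x * F x).
Proof.
have numu : nu `<< mu.
  move=> A A0 B mB BA; have mB0 := A0 _ mB BA.
  rewrite /nu; apply/eqP; rewrite eqe -normr_le0; apply: le_trans (P1 _) _.
  by rewrite rnorm_cls_indic// mB0.
pose f := Radon_Nikodym nu mu.
have ff x : f x \is a fin_num by exact: Radon_Nikodym_fin_num.
have fi : mu.-integrable setT f by exact: Radon_Nikodym_integrable.
have fE : EFin \o (fine \o f) = f by apply/funext => x /=; rewrite fineK.
exists (fine \o f); first by rewrite /rintegrable fE.
move=> A mA; apply: EFin_inj; rewrite -[LHS]/(nu A) (Radon_Nikodym_integral numu)//.
rewrite /Rintegral fineK; last first.
  apply: integrable_fin_num => //; apply: rintegrable_indicM => //.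
  by rewrite /rintegrable fE.
rewrite [LHS]integral_mkcond; apply: eq_integral => x _.
rewrite patchE indicE; case: (x \in A); last by rewrite mul0r.
by rewrite mul1r [RHS](congr1 (fun g => g x) fE).
Qed.

End RealFunctionalDensity.

Import HBSimple.

(** * The dual of L_1 consists of bounded densities *)

Section Riesz.
Context {R : realType} {s : scalars} {d} {Omega : measurableType d}.
Context {mu : {finite_measure set Omega -> \bar R}}.
Local Notation K := (scalar_field R s).

(** A dichotomy that replaces a case split on [s] in later proofs: imaginary parts are either
    faithful or identically 0. *)
Lemma impart_mkK :
  (forall a b, impart (mkK a b : K) = b) \/ (forall x : K, impart x = 0).
Proof. by rewrite /impart /mkK; case: s; [right|left]. Qed.

(** Here [mkK 0 1] is the imaginary unit over the complex numbers and 0 over the reals. *)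
Lemma scalar_decomp (x : K) :
  x = of_real (repart x) + mkK 0 1 * of_real (impart x).
Proof.
apply: scalar_ext; rewrite ?repartD ?impartD mulrC ?repartZ ?impartZ.
  by rewrite repart_of_real repart_mkK mulr0 addr0.
rewrite impart_of_real add0r; have [->|H] := impart_mkK; first by rewrite mulr1.
by rewrite !H mul0r.
Qed.

Lemma simple_function_of_sfun (p : {sfun Omega >-> R}) :
  simple_function (fun x => of_real (p x) : K).
Proof.
split.
  apply: sub_finite_set (finite_image (@of_real R s) (fimfunP p)).
  by move=> _ [x _ <-]; exists (p x) => //; exists x.
move=> v; rewrite (_ : _ @^-1` _ =
    p @^-1` [set r | of_real r = v]); last by [].
rewrite (_ : p @^-1` _ = \bigcup_(r in range p `&` [set r | of_real r = v]) p @^-1` [set r]).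
  apply: fin_bigcup_measurable => [|r _]; last exact: measurable_sfunP.
  apply: finite_setIl; exact: fimfunP.
apply/seteqP; split => [x /= px|x [r [_ /= rv] /= ->]//].
by exists (p x) => //; split => //; exists x.
Qed.

Lemma cls_sum I (t : seq I) (f : I -> Omega -> K) :
  (forall i, Kint_able mu (f i)) ->
  cls mu (fun x => \sum_(i <- t) f i x) = \sum_(i <- t) cls mu (f i).
Proof.
move=> jf; elim: t => [|i t IH].
  rewrite big_nil -[RHS](mulL0 (cls mu \1_setT)); congr cls; apply/funext => x.
  by rewrite big_nil mul0r.
rewrite big_cons -IH -clsD//; last exact: Kint_able_sum.
by congr cls; apply/funext => x; rewrite big_cons.
Qed.

(** By linearity f vanishes on simple functions, by continuity and density on real integrable
    functions, and then on all classes through real and imaginary parts. *)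
Lemma functional_eq0 (f : L1 s mu -> K) (C : R) : @linear_map R s (L1 s mu) K f ->
  (forall u, rnorm (f u) <= C * rnorm u) ->
  (forall A, measurable A -> f (cls mu \1_A) = 0) -> forall u, f u = 0.
Proof.
move=> lf fC f1 u.
have fs (q : Omega -> K) : simple_function q -> f (cls mu q) = 0.
  move=> sq; rewrite (_ : q = fun x =>
      \sum_(v <- fset_set (range q)) v * \1_(q @^-1` [set v]) x); last first.
    by apply/funext => x; exact: (simple_sum id).
  have mq v : measurable (q @^-1` [set v]) by exact: simple_preimage.
  rewrite cls_sum; last by move=> v; exact/Kint_ableZ/Kint_able_indic.
  rewrite (linear_sum_of _ _ _ lf) big1// => v _.
  by rewrite clsZ ?(linearZ_of lf) ?f1 ?mulr0//; [exact: scaler0|exact: Kint_able_indic].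
have jof F : rintegrable mu F -> Kint_able mu (fun x => of_real (F x) : K).
  move=> iF; apply: (Kint_able_dom _ (rintegrable_norm iF)).
    exact: Kmeasurable_of_real (rintegrable_measurable iF).
  by move=> x; rewrite rnorm_of_real.
have fR F : rintegrable mu F -> f (cls mu (fun x => of_real (F x))) = 0.
  move=> iF; have [p [ip _ pF]] := approximation_sfun_integrable measurableT iF.
  apply: rnorm_eq0; apply/le_anti; rewrite rnorm_ge0 andbT.
  apply/ler_addgt0Pr => e e0; rewrite add0r.
  pose B := `|C| + 1; have B0 : 0 < B by rewrite ltr_wpDl.
  have eB0 : 0 < e / B by rewrite divr_gt0.
  have /fine_cvgP[_ /cvgrPdist_le/(_ _ eB0) [N _ /(_ N (leqnn N)) /=]] := pF.
  rewrite sub0r normrN => HN.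
  have jp := jof _ (ip N); have jF := jof _ iF.
  rewrite -[f _]subr0 -(fs _ (simple_function_of_sfun (p N))) -(linearB_of lf) -clsB//.
  apply: le_trans (fC _) _; set w := cls _ _.
  rewrite -(divfK (lt0r_neq0 B0) e) mulrC; apply: (@le_trans _ _ (rnorm w * B)).
    by rewrite ler_wpM2l ?rnorm_ge0// (le_trans (ler_norm _))// lerDl.
  rewrite ler_wpM2r ?(ltW B0)// rnorm_cls; last exact: Kint_ableB.
  apply: le_trans HN; apply: le_trans (ler_norm _).
  by under eq_Rintegral => x _ do rewrite -of_realB rnorm_of_real.
rewrite -(cls_repr u); have ju := Kint_able_repr u.
have [jr ji] := (rintegrable_repart ju, rintegrable_impart ju).
rewrite (_ : (L1repr u : Omega -> K) = fun x => of_real (repart (L1repr u x)) +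
    mkK 0 1 * of_real (impart (L1repr u x))); last first.
  by apply/funext => x; exact: scalar_decomp.
rewrite clsD; [|exact: jof|exact/Kint_ableZ/jof].
rewrite clsZ; last exact: jof.
by rewrite (linearD_of lf) (linearZ_of lf) !fR// scaler0 addr0.
Qed.

Lemma functional_indic_density (f : L1 s mu -> K) : @linear_map R s (L1 s mu) K f ->
  (forall u, rnorm (f u) <= rnorm u) ->
  exists2 g : Omega -> K, Kint_able mu g &
  forall A, measurable A -> f (cls mu \1_A) = Kint mu (fun x => \1_A x * g x).
Proof.
move=> lf f1.
have [F iF FE] := @functional_density R s d Omega mu (fun u => repart (f u))
  (fun u v => etrans (congr1 _ (linearD_of lf u v)) (repartD _ _))
  (fun u => le_trans (normr_repart _) (f1 u)).
have [G iG GE] := @functional_density R s d Omega mu (fun u => impart (f u))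
  (fun u v => etrans (congr1 _ (linearD_of lf u v)) (impartD _ _))
  (fun u => le_trans (normr_impart _) (f1 u)).
have mF := rintegrable_measurable iF; have mG := rintegrable_measurable iG.
exists (fun x => mkK (F x) (G x)).
  apply: (Kint_able_dom _ (rintegrableD (rintegrable_norm iF) (rintegrable_norm iG))).
    split; first by rewrite (_ : _ \o _ = F)//; apply/funext => x /=; rewrite repart_mkK.
    have [H|H] := impart_mkK.
      by rewrite (_ : _ \o _ = G)//; apply/funext => x /=; rewrite H.
    by rewrite (_ : _ \o _ = cst 0)//; apply/funext => x /=; rewrite H.
  move=> x; apply: le_trans (rnorm_le_parts _) _.
  rewrite repart_mkK lerD2l; have [->//|->] := impart_mkK.
  by rewrite normr0.
move=> A mA; apply: scalar_ext.
  rewrite FE// repart_Kint; apply: eq_Rintegral => x _.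
  by rewrite indic_of_real repartZ repart_mkK.
rewrite impart_Kint; have [H|H] := impart_mkK.
  rewrite GE//; apply: eq_Rintegral => x _.
  by rewrite indic_of_real impartZ H.
rewrite H; under eq_Rintegral => x _ do rewrite H.
by rewrite Rintegral_cst// mul0r.
Qed.

(** If |g| exceeds 1 on a set of positive measure, then g is nearly constant on some smaller E of
    positive measure, where no cancellation occurs, and the integral over E is larger than the
    measure of E. *)
Lemma density_le1 (g : Omega -> K) : Kint_able mu g ->
  (forall A, measurable A ->
    rnorm (Kint mu (fun x => \1_A x * g x)) <= fine (mu A)) ->
  {ae mu, forall x, rnorm (g x) <= 1}.
Proof.
have num (c m y e k D : R) : y <= m -> D <= e * m -> k - c <= e ->
    1 + 3 * e <= k -> 0 < m -> 0 < e -> c * m - y <= D -> False.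
  move=> H1 H2 H3 H4 H5 H6 H7.
  have : (1 + 2 * e) * m <= c * m by rewrite ler_wpM2r ?(ltW H5)//; lra.
  by have := mulr_gt0 H5 H6; lra.
move=> jg Hg; have mg := proj1 jg.
(* Of the three units e = 1/(n+1), one is lost in passing from g to the constant c, one in
   integrating over E, and the last gives the contradiction. *)
pose A n := [set x | 1 + 3 * n.+1%:R^-1 <= rnorm (g x)].
have mA n : measurable (A n).
  rewrite -[X in measurable X]setTI; apply: measurable_fun_le => //.
  exact: Kmeasurable_norm.
pose B := ~` [set x | rnorm (g x) <= 1].
have mB : measurable B by exact/measurableC/measurable_rnorm_le.
exists B; split => //; apply/eqP; rewrite eq_le measure_ge0 andbT leNgt.
apply/negP => B0.
have BA : B `<=` \bigcup_n A n.
  move=> x /negP; rewrite -ltNge -subr_gt0 => gx.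
  have gx3 : 0 < (rnorm (g x) - 1) / 3 by rewrite divr_gt0.
  have [n _ /(_ n (leqnn n)) /= Hn] := near_infty_natSinv_lt (PosNum gx3).
  have {}Hn : n.+1%:R^-1 < (rnorm (g x) - 1) / 3 by exact: Hn.
  exists n => //; rewrite /A /=; move: (n.+1%:R^-1) (rnorm (g x)) Hn => a b; lra.
have [n An0] := measure_bigcup_gt0 mA mB BA B0.
have e0 : (0 : R) < n.+1%:R^-1 by rewrite invr_gt0.
set e : R := n.+1%:R^-1 in e0; have [E [c [mE EA E0 Ec]]] := near_constant mg (mA n) An0 e0.
have m0 := fine_mu_gt0 mE E0.
have [x Ex] : E !=set0 by apply/set0P/eqP => E00; move: E0; rewrite E00 measure0 ltxx.
have gx : 1 + 3 * e <= rnorm (g x) by exact: EA.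
have cx : rnorm (g x) - rnorm c <= e by apply: le_trans (ler_rnormB _ _) (Ec _ Ex).
have jEg : Kint_able mu (fun x => \1_E x * g x).
  have bE : bounded_by 1 (fun x => \1_E x : K) by exact: bounded_by_indic.
  exact: (bounded_byM bE jg).
have jE : Kint_able mu (fun x => c * \1_E x) by exact/Kint_ableZ/Kint_able_indic.
have H : rnorm (c * of_real (fine (mu E)) - Kint mu (fun x => \1_E x * g x))
    <= e * fine (mu E).
  rewrite -Kint_indic// -KintZ; last exact: Kint_able_indic.
  rewrite -KintB//; have jB := Kint_ableB jE jEg.
  apply: le_trans (rnorm_Kint_le jB) _.
  have iE : rintegrable mu (fun x => \1_E x : R) by exact: integrable_indic.
  have -> : e * fine (mu E) = \int[mu]_x (e * \1_E x).
    by rewrite RintegralZl// /Rintegral integral_indic// setIT.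
  apply: le_Rintegral => //; [by case: jB|exact: rintegrableZ|].
  move=> y _; rewrite mulrC -mulrBr rnormM rnorm_indic mulrC.
  rewrite !indicE; case: (boolP (y \in E)) => [/set_mem Ey|_]; last by rewrite !mulr0.
  by rewrite !mulr1 rdistC; exact: Ec.
have := ler_rnormB (c * of_real (fine (mu E))) (Kint mu (fun x => \1_E x * g x)).
rewrite rnormM rnorm_of_real (ger0_norm (ltW m0)).
exact: num (Hg E mE) H cx gx m0 e0.
Qed.

(** The density found on indicators is set to 0 where its modulus exceeds 1, a null set. The
    difference of f and the pairing is then a bounded functional vanishing on indicators. *)
Lemma riesz_representation (f : L1 s mu -> K) : dual_sphere f ->
  exists2 g, bounded_by 1 g & forall u, f u = pairing g u.
Proof.
move=> df; have [[lf _] _] := df.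
have f1 u := dual_sphere_le u df.
have [g0 jg0 fE] := functional_indic_density lf f1.
have mg0 := proj1 jg0.
have g01 : {ae mu, forall x, rnorm (g0 x) <= 1}.
  by apply: density_le1 => // A mA; rewrite -fE// -(@rnorm_cls_indic R s).
pose G := [set x | rnorm (g0 x) <= 1].
have mG : measurable G by exact: measurable_rnorm_le.
pose g x := if x \in G then g0 x else 0.
have bg : bounded_by 1 g.
  split; first by apply: Kmeasurable_if => //; exact: Kmeasurable_cst.
  by move=> x; rewrite /g; case: ifPn => [/set_mem//|_]; rewrite rnorm0.
exists g => // u.
have lg := pairing_linear (mu := mu) bg.
suff : f u - pairing g u = 0 by move/eqP; rewrite subr_eq0 => /eqP.
apply: (@functional_eq0 (fun u => f u - pairing g u) 2).
- move=> c v w; rewrite (lf c v w) (lg c v w) scalerBr.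
  by rewrite opprD addrACA.
- move=> v; apply: le_trans (rnormB _ _) _; rewrite mulr_natl mulr2n lerD//.
  by have := rnorm_pairing_le bg v; rewrite mul1r.
move=> A mA; apply/eqP; rewrite subr_eq0; apply/eqP.
rewrite fE// (pairing_cls bg); last exact: Kint_able_indic.
apply: Kint_ae.
- by apply: KmeasurableM => //; exact: Kmeasurable_indic.
- by apply: KmeasurableM; [case: bg|exact: Kmeasurable_indic].
by apply: filterS g01 => x gx; rewrite mulrC /g mem_set.
Qed.

End Riesz.

(** * Perturbing a norming functional *)

Section NormingPairs.
Context {R : realType} {s : scalars} {d} {Omega : measurableType d}.
Context {mu : {finite_measure set Omega -> \bar R}}.
Local Notation K := (scalar_field R s).

(** The equality case of |int g u| <= int |u|: the nonnegative function |u| - Re(g u) has integral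
    0, so it vanishes almost everywhere. *)
Lemma norming_pair_ae (g : Omega -> K) (u : L1 s mu) : bounded_by 1 g ->
  rnorm u = 1 -> pairing g u = 1 -> {ae mu, forall x,
    g x * L1repr u x = of_real (rnorm (L1repr u x)) /\
    (rnorm (g x) = 1 \/ rnorm (L1repr u x) = 0)}.
Proof.
move=> bg u1 gu; have [_ ju] := Kint_able_repr u.
have jgu := bounded_byM bg (Kint_able_repr u).
have jr := rintegrable_repart jgu.
have le x : repart (g x * L1repr u x) <= rnorm (L1repr u x).
  rewrite (le_trans (ler_repart _))// rnormM ler_piMl ?rnorm_ge0//.
  by case: bg.
have /Rintegral_eq0_ae : rintegrable mu
  (fun x => rnorm (L1repr u x) - repart (g x * L1repr u x)) by exact: rintegrableB.
case.
- by apply: aeW => x; rewrite subr_ge0.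
- by rewrite RintegralB// -rnorm_L1 u1 -repart_Kint [Kint _ _]gu repart1 subrr.
move=> N [mN N0 HN]; exists N; split => // x; apply: contra_notP => xN.
have /eqP : rnorm (L1repr u x) - repart (g x * L1repr u x) = 0.
  by apply: contrapT => h; apply: xN; apply: HN.
rewrite subr_eq0 => /eqP E.
have gule : rnorm (g x * L1repr u x) <= rnorm (L1repr u x).
  by rewrite rnormM ler_piMl ?rnorm_ge0//; case: bg.
have E1 : rnorm (g x * L1repr u x) = rnorm (L1repr u x).
  by apply/le_anti; rewrite gule {1}E ler_repart.
split; first by rewrite -E1; apply: repart_eq_rnorm; rewrite E1.
have [->|u0] := eqVneq (rnorm (L1repr u x)) 0; first by right.
by left; apply: (mulIf u0); rewrite mul1r -rnormM.
Qed.

(** For g x nonzero, [conjK (sgnK (g x))] is g x / |g x|: the phase is kept and a modulus of at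
    least 1 - t becomes 1. *)
Definition rectify (t : R) (g : Omega -> K) : Omega -> K :=
  fun x => if x \in [set x | 1 - t <= rnorm (g x)] then conjK (sgnK (g x)) else g x.

Section Rectify.
Variables (t : R) (g : Omega -> K).
Hypotheses (t01 : 0 < t < 1) (bg : bounded_by 1 g).

Lemma measurable_rnorm_ge (r : R) : measurable [set x | r <= rnorm (g x)].
Proof.
rewrite -[X in measurable X]setTI; apply: measurable_fun_le => //.
by apply: Kmeasurable_norm; case: bg.
Qed.

Lemma bounded_by_rectify : bounded_by 1 (rectify t g).
Proof.
have [mg g1] := bg; split; last first.
  move=> x; rewrite /rectify; case: ifP => // _.
  by rewrite rnorm_conjK rnorm_sgnK.
apply: Kmeasurable_if => //; first exact: measurable_rnorm_ge.
exact/Kmeasurable_conjK/Kmeasurable_sgnK.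
Qed.

Lemma rectify_near x : rnorm (rectify t g x - g x) <= t.
Proof.
have /andP[t0 t1] := t01; have g1 := proj2 bg x.
rewrite /rectify; case: ifPn => [|_]; last by rewrite subrr rnorm0 ltW.
rewrite inE /= => gt.
have {2}-> : g x = of_real (rnorm (g x)) * conjK (sgnK (g x)).
  by rewrite -sgnKM mulrAC [sgnK _ * conjK _]mulrC conjK_unimodular ?mul1r ?rnorm_sgnK.
rewrite -{1}[conjK _]mul1r -mulrBl rnormM rnorm_conjK rnorm_sgnK mulr1.
by rewrite -of_real1 -of_realB rnorm_of_real ger0_norm; lra.
Qed.

Lemma rectify_id x : rnorm (g x) = 1 -> rectify t g x = g x.
Proof.
have /andP[t0 t1] := t01.
move=> gx; rewrite /rectify mem_set /=; last by rewrite gx; lra.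
have := sgnKM (g x); rewrite gx of_real1 => sg.
by rewrite -[LHS]mulr1 -sg mulrA conjK_unimodular ?mul1r// rnorm_sgnK.
Qed.

(** Integrating [rnorm_sub_phase_le] gives a vector p aligned with g at distance at most t + t^2/t =
    2 t from k. Its norm is at least 1 - t^2 - 2 t >= 1 - 3 t > 0, so normalising costs at most 3 t
    more, which makes 5 t. *)
Lemma near_norming (k : L1 s mu) : 3 * t < 1 -> rnorm k <= 1 ->
  1 - t ^+ 2 <= repart (pairing g k) ->
  exists w : L1 s mu, [/\ rnorm w = 1, pairing (rectify t g) w = 1 &
    rnorm (k - w) <= 5 * t].
Proof.
move=> t3 k1 gk; have /andP[t0 t1] := t01.
have [mk jk] := Kint_able_repr k.
have [mg g1] := bg.
have jgk := bounded_byM bg (Kint_able_repr k).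
have k1' : 1 - t ^+ 2 <= rnorm k.
  apply: le_trans gk _; apply: le_trans (ler_repart _) _.
  by have := rnorm_pairing_le bg k; rewrite mul1r.
pose B := [set x | 1 - t <= rnorm (g x)].
have mB : measurable B by exact: measurable_rnorm_ge.
(* On B, p has the modulus of k and the phase for which the product with the rectified density is
   |p|; off B, where that density may have modulus below 1, p is 0. *)
pose p x : K := if x \in B then sgnK (g x) * of_real (rnorm (L1repr k x)) else 0.
have np x : rnorm (p x) = if x \in B then rnorm (L1repr k x) else 0.
  rewrite /p; case: ifP => _; last exact: rnorm0.
  by rewrite rnormM rnorm_sgnK mul1r rnorm_of_real ger0_norm// rnorm_ge0.
have mp : Kmeasurable p.
  apply: Kmeasurable_if => //; last exact: Kmeasurable_cst.
  apply: KmeasurableM; first exact: Kmeasurable_sgnK.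
  exact/Kmeasurable_of_real/Kmeasurable_norm.
have jp : Kint_able mu p.
  apply: (Kint_able_dom mp jk) => x; rewrite np; case: ifP => // _.
  exact: rnorm_ge0.
have pk x : rnorm (L1repr k x - p x) <=
    t * rnorm (L1repr k x) + t^-1 * (rnorm (L1repr k x) - repart (g x * L1repr k x)).
  have := rnorm_sub_phase_le (L1repr k x) t01 (g1 x); rewrite /p.
  case: (boolP (x \in B)) => [/set_mem xB|/negP xB]; first by rewrite xB.
  by case: ifP => // h; exfalso; apply: xB; exact: mem_set.
have kp : rnorm (k - cls mu p) <= 2 * t.
  have -> : k - cls mu p = cls mu (fun x => L1repr k x - p x).
    by rewrite clsB ?cls_repr//; exact: Kint_able_repr.
  have jkp := Kint_ableB (Kint_able_repr k) jp.
  rewrite rnorm_cls//.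
  have jr := rintegrable_repart jgk.
  have jD := rintegrableB jk jr.
  apply: (@le_trans _ _ (\int[mu]_x (t * rnorm (L1repr k x) + t^-1 *
      (rnorm (L1repr k x) - repart (g x * L1repr k x))))).
    apply: le_Rintegral => //; first by case: jkp.
    by apply: rintegrableD; apply: rintegrableZ.
  rewrite RintegralD//; [|exact: rintegrableZ|exact: rintegrableZ].
  rewrite !RintegralZl// RintegralB// -rnorm_L1 -repart_Kint.
  rewrite -[Kint _ _]/(pairing g k).
  have h1 : t * rnorm k <= t by rewrite ler_piMr// ltW.
  have h2 : t^-1 * (rnorm k - repart (pairing g k)) <= t.
    by rewrite mulrC ler_pdivrMr// -expr2; lra.
  by lra.
pose N := rnorm (cls mu p).
have N1 : N <= 1.
  apply: le_trans k1; rewrite /N rnorm_cls// rnorm_L1.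
  apply: le_Rintegral => //; first by case: jp.
  by move=> x _; rewrite np; case: ifP => // _; exact: rnorm_ge0.
have N3 : 1 - 3 * t <= N.
  have := ler_rnormB k (cls mu p); rewrite -/N => h.
  have : t ^+ 2 <= t by rewrite expr2 ler_piMr// ltW.
  by lra.
have N0 : 0 < N by lra.
pose w := of_real N^-1 *: cls mu p.
have pE : cls mu p = of_real N *: w.
  by rewrite scalerA -of_realM mulfV ?gt_eqF// of_real1 scale1r.
have w1 : rnorm w = 1 by rewrite rnormZ_of_real ?invr_ge0 ?(ltW N0)// mulVf// gt_eqF.
exists w; split => //.
  rewrite (linearZ_of (pairing_linear (mu := mu) bounded_by_rectify)).
  rewrite (pairing_cls bounded_by_rectify)//.
  rewrite (_ : (fun x => _) = fun x => of_real (rnorm (p x))).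
    rewrite Kint_of_real; last by case: jp.
    rewrite -rnorm_cls// -/N -[_ *: _]of_realM mulVf ?gt_eqF//.
    exact: of_real1.
  apply/funext => x; rewrite np /p /rectify -/B; case: ifPn => xB.
    by rewrite mulrA conjK_unimodular ?mul1r// rnorm_sgnK.
  by rewrite mulr0 of_real0.
apply: le_trans (ler_rdist_add (cls mu p) _ _) _.
have : rnorm (cls mu p - w) = 1 - N.
  rewrite pE -{2}[w]scale1r -scalerBl -of_real1 -of_realB rnormZ w1 mulr1.
  by rewrite rnorm_of_real distrC ger0_norm// subr_ge0.
by lra.
Qed.

End Rectify.

End NormingPairs.

(** * The Bishop-Phelps-Bollobas property *)

(** A Markov inequality: each bad index loses at least tau^2 m v, and the total loss is at most 2
    eta = tau^3/2, so the bad mass is at most tau/2. The good mass is thus at least 1 - eta - tau/2,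
    and eta <= tau/4. *)
Lemma sum_near_max_ge (R : realFieldType) (I : Type) (t : seq I) (m r : I -> R)
    (tau eta : R) : (forall v, 0 <= m v) -> (forall v, r v <= 1) -> 0 < tau ->
  4 * eta = tau * tau ^+ 2 -> 4 * eta <= tau ->
  1 - eta <= \sum_(v <- t) m v <= 1 -> 1 - 2 * eta <= \sum_(v <- t) m v * r v ->
  1 - tau <= \sum_(v <- t | (0 < m v) && (1 - tau ^+ 2 < r v)) m v.
Proof.
move=> m0 r1 tau0 etaE etat /andP[sm1 sm2] smr.
set J := fun v => (0 < m v) && (1 - tau ^+ 2 < r v).
have tau2 : 0 < tau ^+ 2 by rewrite exprn_gt0.
have H : tau ^+ 2 * \sum_(v <- t | ~~ J v) m v <= \sum_(v <- t) (m v - m v * r v).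
  rewrite mulr_sumr big_mkcond; apply: ler_sum => v _.
  have h : m v * r v <= m v by rewrite ler_piMr.
  case: ifPn => [|_]; last by rewrite subr_ge0.
  rewrite negb_and -!leNgt => /orP[mv|rv].
    have -> : m v = 0 by apply/le_anti; rewrite mv m0.
    by rewrite mulr0 mul0r subrr.
  by have := ler_wpM2l (m0 v) rv; lra.
have H1 : \sum_(v <- t | ~~ J v) m v <= tau / 2.
  by rewrite -(ler_pM2l tau2); apply: le_trans H _; rewrite sumrB; lra.
by move: sm1; rewrite (bigID J) /= -/J; lra.
Qed.

Section Main.
Context {R : realType} {s : scalars} {d} {Omega : measurableType d}.
Context {mu : {finite_measure set Omega -> \bar R}}.
Local Notation K := (scalar_field R s).

Lemma rnorm_unscale (V : normedModType K) (c a : R) (x y : V) : 0 < c ->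
  rnorm (of_real c *: x - of_real c *: y) <= a * c -> rnorm (x - y) <= a.
Proof.
by move=> c0; rewrite -scalerBr (rnormZ_of_real _ (ltW c0)) mulrC ler_pM2r.
Qed.

(** The chain z ~ c v ~ c k ~ c conj(lam) w. In the application z = S(u 1_A), c = f0(u 1_A), k is
    the normalised image of x0 1_A, lam is the common phase and w is normed by f1. *)
Lemma rnorm_rank_one_perturbation (V : normedModType K) (z v k w : V)
    (c lam : K) (n a b : R) : rnorm lam = 1 -> rnorm c <= n ->
  rnorm (z - c *: v) <= a * n -> rnorm (k - v) <= a ->
  rnorm (lam *: k - w) <= b ->
  rnorm ((conjK lam * c) *: w - z) <= (a + (a + b)) * n.
Proof.
move=> lam1 cn zv kv kw.
have lamC : conjK lam * lam = 1 by exact: conjK_unimodular.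
have kw' : rnorm (k - conjK lam *: w) <= b.
  apply: le_trans kw; rewrite -[k]scale1r -lamC -scalerA -scalerBr rnormZ.
  by rewrite rnorm_conjK lam1 mul1r scalerA lamC scale1r.
rewrite rdistC mulrC -scalerA.
apply: le_trans (ler_rdist_add (c *: v) _ _) _.
rewrite mulrDl; apply: lerD => //; rewrite -scalerBr rnormZ mulrC.
apply: ler_pM; rewrite ?rnorm_ge0//.
by apply: le_trans (ler_rdist_add k _ _) _; rewrite rdistC; apply: lerD.
Qed.

(** Dropping z and rescaling y to norm 1 each cost 1 - m; it is applied to the parts of x0 on and
    off the good pieces. *)
Lemma rnorm_normalize_sub (V : normedModType K) (y z : V) (m : R) :
  0 < m -> rnorm y = m -> rnorm z + m = 1 ->
  rnorm (of_real m^-1 *: y - (z + y)) <= 2 * (1 - m).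
Proof.
move=> m0 ym zm; have m1 : 0 <= 1 - m by rewrite -zm addrK rnorm_ge0.
rewrite opprD addrCA addrC; apply: le_trans (rnormB _ _) _.
rewrite mulr_natl mulr2n; apply: lerD; last by rewrite -zm addrK.
rewrite -{2}[y]scale1r -scalerBl -of_real1 -of_realB rnormZ rnorm_of_real ym.
have -> : m^-1 - 1 = m^-1 * (1 - m) by rewrite mulrBr mulr1 mulVf// gt_eqF.
by rewrite ger0_norm ?mulr_ge0 ?invr_ge0 ?(ltW m0)// mulrAC mulVf ?mul1r// gt_eqF.
Qed.

Lemma finite_rank_pairing (C : R) (c : K) (g : Omega -> K) (w : L1 s mu) :
  0 <= C -> bounded_by C g ->
  finite_rank (fun u : L1 s mu => (c * pairing g u) *: w).
Proof.
move=> C0 bg; have lg := pairing_linear (mu := mu) bg.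
split; last first.
  exists 1%N, (fun=> w) => u; exists (fun=> c * pairing g u).
  by rewrite big_ord1.
split.
  move=> a u v; rewrite (lg a u v) mulrDr scalerDl scalerA; congr (_ *: _ + _).
  by rewrite mulrCA.
exists (rnorm c * C * rnorm w) => u; rewrite rnormZ rnormM.
rewrite [leRHS](_ : _ = rnorm c * (C * rnorm u) * rnorm w); last by ring.
rewrite ler_wpM2r ?rnorm_ge0// ler_wpM2l ?rnorm_ge0//.
exact: rnorm_pairing_le bg u.
Qed.

Lemma linear_subspace_sum (M : set (L1 s mu -> L1 s mu)) (I : Type) (t : seq I)
    (P : pred I) (F : I -> L1 s mu -> L1 s mu) : linear_subspace M ->
  (forall i, M (F i)) -> M (fun u => \sum_(i <- t | P i) F i u).
Proof.
move=> [M0 ML] MF; elim: t => [|i t IH].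
  by rewrite (_ : (fun u => _) = fun=> 0)//; apply/funext => u; rewrite big_nil.
case: (boolP (P i)) => Pi.
  rewrite (_ : (fun u => _) = fun u => 1 *: F i u + \sum_(i <- t | P i) F i u).
    exact: ML.
  by apply/funext => u; rewrite big_cons Pi scale1r.
rewrite (_ : (fun u => _) = fun u => \sum_(i <- t | P i) F i u)//.
by apply/funext => u; rewrite big_cons (negPf Pi).
Qed.

Lemma exists_near_attaining (M : set (L1 s mu -> L1 s mu)) :
  linear_subspace M -> [set T | finite_rank T] `<=` M ->
  M `<=` [set T | representable T] ->
  (forall (A : set Omega) (mA : measurable A) (T : L1 s mu -> L1 s mu),
     M T -> M (restrict_op mA T)) ->
  BPBp_nu_with M (fun eps => (eps / 8) ^+ 3 / 4).
Proof.
move=> LM FM MR MA eps /andP[eps0 eps1] S x0 f0 MS nS x01 df0 f0x0 Sx0.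
(* On a good piece the replacement costs at most eta + (eta + 5 tau) <= 7 tau; the eighth tau makes
   the inequality strict. *)
pose tau := eps / 8.
have tau0 : 0 < tau by rewrite divr_gt0.
have tau8 : 8 * tau = eps by rewrite mulrC divfK.
have tau1 : 3 * tau < 1 by lra.
have t01 : 0 < tau < 1 by apply/andP; split; lra.
rewrite -/tau in Sx0.
pose eta := tau ^+ 3 / 4.
have eta0 : 0 < eta by rewrite divr_gt0// exprn_gt0.
have tau2 : 0 < tau ^+ 2 by rewrite exprn_gt0.
have etaE : 4 * eta = tau * tau ^+ 2 by rewrite /eta mulrC divfK// -exprS.
have etat : 4 * eta <= tau.
  by rewrite etaE ler_piMr ?(ltW tau0)// expr_le1//; lra.
have h7 : eta + (eta + 5 * tau) <= 7 * tau by lra.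
have tau7 : 7 * tau < eps by lra.
have tau2' : 2 * tau < eps by lra.
have tau1' : tau < eps by lra.
have tau1p : 0 < 1 - tau by lra.
have num1 (a b : R) : 1 - eta < a + b -> b <= eta -> 1 - 2 * eta <= a by lra.
have num2 (a b : R) : a + b = 1 -> 0 <= a -> a <= eta -> 1 - eta <= b <= 1.
  by move=> h1 h2 h3; apply/andP; split; lra.
have rS := MR _ MS; have [[lS bS] _] := rS.
have S1 : forall u, rnorm (S u) <= rnorm u.
  by apply: le_numerical_radius => //; rewrite nS.
have [g0 bg0 f0E] := riesz_representation df0.
have [mg0 g01] := bg0.
have lg0 := pairing_linear (mu := mu) bg0.
have g0x0 : pairing g0 x0 = 1 by rewrite -f0E.
have pg0 (u : L1 s mu) : rnorm (pairing g0 u) <= rnorm u.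
  by have := rnorm_pairing_le bg0 u; rewrite mul1r.
have nae := norming_pair_ae bg0 x01 g0x0.
have [mx0 jx0] := Kint_able_repr x0.
(* With density g0 and weight |x0|: the pieces lie where |g0| = 1, and what they leave uncovered
   there is measured by the mass of x0. *)
have [t [A [ut dA mA [gA FA HA]]]] :=
  representable_local rS bg0 jx0 (fun x => rnorm_ge0 _) eta0 eta0.
have bA v : bounded_by 1 (fun x => \1_(A v) x : K) by exact: bounded_by_indic.
have lA v : linear_map (mulL \1_(A v) : L1 s mu -> L1 s mu).
  exact: (mulL_linear (bA v)).
pose m v := rnorm (mulL \1_(A v) x0).
have m0 v : 0 <= m v by exact: rnorm_ge0.
(* Since g0 norms x0, g0 x0 = |x0| almost everywhere, hence g0 norms every restriction of x0. *)
have pairA (D : set Omega) : measurable D ->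
    pairing g0 (mulL \1_D x0) = of_real (rnorm (mulL \1_D x0)).
  move=> mD; have bD : bounded_by 1 (fun x => \1_D x : K) by exact: bounded_by_indic.
  rewrite (pairing_mulL _ bg0 bD) rnorm_mulL_indic// -Kint_of_real; last first.
    exact: rintegrable_indicM.
  apply: Kint_ae.
  - by apply: KmeasurableM => //; apply: KmeasurableM => //; exact: Kmeasurable_indic.
  - apply: Kmeasurable_of_real; apply: measurable_funM.
      exact: measurable_indic.
    exact: Kmeasurable_norm.
  apply: filterS nae => x [gx _].
  by rewrite mulrAC gx mulrC indic_of_real of_realM.
pose U := union_of t predT A.
have mU : measurable U by exact: measurable_union_of.
have nU : rnorm (mulL \1_(~` U) x0) <= eta.
  rewrite rnorm_mulL_indic; last exact: measurableC.
  apply: le_trans FA; apply: le_Rintegral_ae.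
  - by apply: rintegrable_indicM => //; exact: measurableC.
  - apply: rintegrable_indicM => //; apply: measurableD => //.
    exact: measurable_rnorm_eq.
  (* Where |g0| is not 1, x0 vanishes almost everywhere, so restricting the pieces to that level set
     loses no mass. *)
  apply: filterS nae => x [_ [gx|->]]; last by rewrite !mulr0.
  rewrite ler_wpM2r ?rnorm_ge0// !indicE ler_nat.
  case: (boolP (x \in ~` U)) => //= /set_mem nUx.
  by rewrite mem_set.
(* One phase for all pieces: after multiplication by it the near-maximal sum is real, so the pieces
   can be compared by real parts. *)
pose lam : K := sgnK (pairing g0 (S x0)).
have lam1 : rnorm lam = 1 by exact: rnorm_sgnK.
have lamE : lam * pairing g0 (S x0) = of_real (rnorm (f0 (S x0))).
  by rewrite f0E sgnKM.
have lamC : conjK lam * lam = 1 by exact: conjK_unimodular.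
(* The image of the normalised restriction of x0; on a piece with [m v = 0] the inverse of 0 is 0,
   hence [k v = 0]. *)
pose k v : L1 s mu := of_real (m v)^-1 *: S (mulL \1_(A v) x0).
have kE v : S (mulL \1_(A v) x0) = of_real (m v) *: k v.
  have [mv0|mv0] := eqVneq (m v) 0.
    by rewrite mv0 of_real0 scale0r (rnorm_eq0 mv0) (linear0_of lS).
  by rewrite scalerA -of_realM mulfV// of_real1 scale1r.
have k1 v : rnorm (k v) <= 1.
  rewrite rnormZ_of_real ?invr_ge0//; have [->|mv0] := eqVneq (m v) 0.
    by rewrite invr0 mul0r.
  by rewrite -(mulVf mv0) ler_wpM2l ?invr_ge0//; exact: S1.
pose r v := repart (pairing g0 (lam *: k v)).
have nlk v : rnorm (lam *: k v) <= 1 by rewrite rnormZ lam1 mul1r.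
have r1 v : r v <= 1.
  by rewrite (le_trans (ler_repart _))// (le_trans (pg0 _)).
have sumr : 1 - 2 * eta <= \sum_(v <- t) m v * r v.
  have mrE v : m v * r v = repart (lam * pairing g0 (S (mulL \1_(A v) x0))).
    by rewrite kE /r -repartZ !(linearZ_of lg0); congr repart; exact: mulrCA.
  have E : rnorm (f0 (S x0)) = \sum_(v <- t) m v * r v +
      repart (lam * pairing g0 (S (mulL \1_(~` U) x0))).
    rewrite -(@repart_of_real R s (rnorm _)) -lamE -{1}(mulL_indicC x0 mU).
    rewrite (linearD_of lS) (linearD_of lg0) mulrDr repartD addrC; congr (_ + _).
    rewrite (mulL_union_of _ ut)// (linear_sum_of _ _ _ lS).
    rewrite (linear_sum_of _ _ _ lg0) mulr_sumr repart_sum.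
    by apply: eq_bigr => v _; rewrite mrE.
  have : repart (lam * pairing g0 (S (mulL \1_(~` U) x0))) <= eta.
    rewrite (le_trans (ler_repart _))// rnormM lam1 mul1r.
    by rewrite (le_trans (pg0 _))// (le_trans (S1 _)).
  by apply: num1; rewrite -E.
(* Positive mass allows division by [m v] when [k v] is compared with v; the threshold tau^2 is the
   defect that [near_norming] turns into a distance 5 tau. *)
pose J v := (0 < m v) && (1 - tau ^+ 2 < r v).
pose A' := union_of t J A.
have mA' : measurable A' by exact: measurable_union_of.
have bA' : bounded_by 1 (fun x => \1_A' x : K) by exact: bounded_by_indic.
have summ : \sum_(v <- t) m v = rnorm (mulL \1_U x0).
  by rewrite rnorm_mulL_union_of.
have summ1 : 1 - eta <= \sum_(v <- t) m v <= 1.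
  by apply: (num2 _ _ _ (rnorm_ge0 _) nU); rewrite summ rnorm_mulL_indicC.
pose mJ := rnorm (mulL \1_A' x0).
have mJE : mJ = \sum_(v <- t | J v) m v by rewrite /mJ rnorm_mulL_union_of.
have mJ1 : mJ <= 1.
  by rewrite -x01 -[leRHS](rnorm_mulL_indicC x0 mA') lerDr rnorm_ge0.
have mJt : 1 - tau <= mJ by rewrite mJE; exact: sum_near_max_ge etaE etat summ1 sumr.
have mJ0 : 0 < mJ by exact: lt_le_trans mJt.
have exw v : exists w : L1 s mu, J v -> [/\ rnorm w = 1,
    pairing (rectify tau g0) w = 1 & rnorm (lam *: k v - w) <= 5 * tau].
  case: (boolP (J v)) => [/andP[mv rv]|_]; last by exists 0.
  by have [w Hw] := near_norming t01 bg0 tau1 (nlk v) (ltW rv); exists w.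
have [w Hw] := choice exw.
pose g1 := rectify tau g0.
have bg1 : bounded_by 1 g1 by exact: bounded_by_rectify.
have lg1 := pairing_linear (mu := mu) bg1.
pose x1 : L1 s mu := of_real mJ^-1 *: mulL \1_A' x0.
have mJV : 0 <= mJ^-1 by rewrite invr_ge0 ltW.
have x11 : rnorm x1 = 1 by rewrite rnormZ_of_real// mulVf// gt_eqF.
have g1x1 : pairing g1 x1 = 1.
  rewrite (linearZ_of lg1) (_ : pairing g1 _ = of_real mJ).
    by rewrite -[_ *: _]of_realM mulVf ?of_real1// gt_eqF.
  (* A' lies in the set |g0| = 1, which rounding does not alter, so g1 and g0 have the same effect
     on the restriction of x0. *)
  rewrite -pairA// (pairing_mulL _ bg1 bA') (pairing_mulL _ bg0 bA').
  congr Kint; apply/funext => x; congr (_ * _).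
  rewrite indicE; case: (boolP (x \in A')) => [/set_mem[v [_ _ Avx]]|_].
    by rewrite /g1 rectify_id//; exact: gA Avx.
  by rewrite !mulr0.
(* [w v] approximates [lam *: k v], so the factor [conjK lam] undoes the common phase and F stays
   close to S on the piece. *)
pose F v (u : L1 s mu) := (conjK lam * pairing g0 (mulL \1_(A v) u)) *: w v.
pose T (u : L1 s mu) := S (mulL \1_(~` A') u) + \sum_(v <- t | J v) F v u.
have MF v : M (F v).
  apply: FM; rewrite /= (_ : F v = fun u =>
    (conjK lam * pairing (fun x => g0 x * \1_(A v) x) u) *: w v).
    by apply: (@finite_rank_pairing 1) => //; exact: bounded_by_mul1.
  by apply/funext => u; rewrite /F (pairing_mulL _ bg0 (bA v)).
have MT : M T.
  have := linear_subspace_sum t J LM MF.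
  move=> /((proj2 LM) 1 _ _ (MA _ (measurableC mA') _ MS)).
  congr M; apply/funext => u.
  by rewrite /T scale1r /restrict_op indic_mul_mulL.
have nF v u : J v -> rnorm (F v u) <= rnorm (mulL \1_(A v) u).
  move=> /Hw[w1 _ _]; rewrite rnormZ w1 mulr1 rnormM rnorm_conjK lam1 mul1r; exact: pg0.
(* S off A' and each F v on its own piece are contractions, and the norms of the restrictions of u
   add up to the norm of u. *)
have T1 u : rnorm (T u) <= rnorm u.
  apply: le_trans (rnormD _ _) _.
  rewrite -[leRHS](rnorm_mulL_indicC u mA'); apply: lerD; first exact: S1.
  rewrite (rnorm_mulL_union_of _ _ ut dA mA); apply: le_trans (rnorm_sum _ _ _) _.
  by apply: ler_sum => v Jv; exact: nF.
have SE u : S u = S (mulL \1_(~` A') u) + \sum_(v <- t | J v) S (mulL \1_(A v) u).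
  rewrite -{1}(mulL_indicC u mA') (linearD_of lS); congr (_ + _).
  by rewrite (mulL_union_of _ ut)// (linear_sum_of _ _ _ lS).
have Ddiff v u : J v ->
    rnorm (F v u - S (mulL \1_(A v) u)) <= 7 * tau * rnorm (mulL \1_(A v) u).
  move=> Jv; have [w1 _ kw] := Hw _ Jv; have /andP[mv rv] := Jv.
  (* The local estimate at u = x0, where g0(x0 1_A) is exactly [m v], divided by [m v]. *)
  have kv : rnorm (k v - v) <= eta.
    by apply: (rnorm_unscale mv); rewrite -kE /m -(pairA _ (mA v)); exact: HA.
  apply: le_trans (rnorm_rank_one_perturbation lam1 (pg0 _) (HA v u) kv kw) _.
  by apply: ler_wpM2r h7; exact: rnorm_ge0.
have TS u : rnorm (T u - S u) <= 7 * tau * rnorm u.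
  rewrite (SE u) /T opprD addrACA subrr add0r -sumrB.
  apply: le_trans (rnorm_sum _ _ _) _.
  apply: (@le_trans _ _ (\sum_(v <- t | J v) 7 * tau * rnorm (mulL \1_(A v) u))).
    by apply: ler_sum => v Jv; exact: Ddiff.
  rewrite -mulr_sumr -(rnorm_mulL_union_of _ _ ut dA mA); apply: ler_wpM2l.
    by rewrite mulr_ge0// ltW.
  by rewrite -[leRHS](rnorm_mulL_indicC u mA') lerDr rnorm_ge0.
have pg1 (u : L1 s mu) : rnorm (pairing g1 u) <= rnorm u.
  by have := rnorm_pairing_le bg1 u; rewrite mul1r.
have dg1 := dual_sphere_of lg1 pg1 x11 g1x1.
(* Every good piece contributes with the same phase [conjK lam] and weight [m v / mJ], and the
   weights sum to 1; the part of T off A' does not see x1. *)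
have g1T : pairing g1 (T x1) = conjK lam.
  have x1A' : mulL \1_(~` A') x1 = 0.
    have bC : bounded_by 1 (fun x => \1_(~` A') x : K).
      by apply: bounded_by_indic; exact: measurableC.
    rewrite (linearZ_of (mulL_linear bC)) (mulL_mulL _ bC bA').
    rewrite -[RHS](scaler0 _ (of_real mJ^-1)); congr (_ *: _).
    rewrite -[RHS](mulL0 x0); congr mulL; apply/funext => x.
    by rewrite !indicE in_setC; case: (_ \in _); rewrite ?mul0r ?mulr0.
  rewrite /T x1A' (linear0_of lS) add0r (linear_sum_of _ _ _ lg1).
  rewrite big_seq_cond (eq_bigr (fun v => conjK lam * of_real (mJ^-1 * m v))).
    rewrite -big_seq_cond -mulr_sumr -of_real_sum -mulr_sumr -mJE mulVf ?gt_eqF//.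
    by rewrite of_real1 mulr1.
  move=> v /andP[vt Jv]; have [_ g1w _] := Hw _ Jv.
  rewrite /F (linearZ_of lg1) g1w [LHS]mulr1; congr (_ * _).
  rewrite /x1 (linearZ_of (lA v)) (linearZ_of lg0) (mulL_mulL _ (bA v) bA').
  rewrite (_ : mulL _ x0 = mulL \1_(A v) x0).
    by rewrite pairA// -[_ *: _]of_realM.
  congr mulL; apply/funext => x; rewrite !indicE.
  case: (boolP (x \in A v)) => [/set_mem Avx|_]; last by rewrite mul0r.
  by rewrite mem_set ?mulr1//; exists v.
have g1T1 : rnorm (pairing g1 (T x1)) = 1 by rewrite g1T rnorm_conjK.
have nT : numerical_radius T = 1.
  apply/le_anti/andP; split.
    by apply: numerical_radius_le => // u; rewrite mul1r.
  rewrite -{1}g1T1; apply: numerical_radius_ge => //.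
  by case: (MR _ MT).
have x10 : rnorm (x1 - x0) <= 2 * tau.
  have h : rnorm (mulL \1_(~` A') x0) + mJ = 1.
    by rewrite -x01; exact: rnorm_mulL_indicC.
  have := rnorm_normalize_sub mJ0 (erefl mJ) h.
  rewrite (mulL_indicC x0 mA') => /le_trans; apply.
  by apply: ler_wpM2l => //; rewrite lerBlDr addrC -lerBlDr.
exists T, x1, (pairing g1); split; split => //; split => //.
- apply: le_lt_trans (numerical_radius_le _ TS) tau7.
  by rewrite mulr_ge0// ltW.
- exact: le_lt_trans x10 tau2'.
apply: le_lt_trans tau1'.
apply: opnorm_le; first exact: ltW.
move=> u; rewrite f0E.
have ju := Kint_able_repr u.
have bB : bounded_by tau (fun x => g1 x - g0 x).
  by split => [|x]; [apply: KmeasurableB => //; case: bg1|exact: rectify_near].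
rewrite (_ : _ - _ = pairing (fun x => g1 x - g0 x) u).
  exact: rnorm_pairing_le.
rewrite /pairing -KintB; [|exact: (bounded_byM bg1 ju)|exact: (bounded_byM bg0 ju)].
by congr Kint; apply/funext => x; rewrite mulrBl.
Qed.

End Main.

Theorem theorem2p7 (R : realType) (s : scalars) :
  exists eta : R -> R, (forall eps : R, 0 < eps < 1 -> 0 < eta eps) /\
  forall (d : measure_display) (Omega : measurableType d)
    (mu : {finite_measure set Omega -> \bar R})
    (M : set (L1 s mu -> L1 s mu)),
  linear_subspace M ->
  [set T | finite_rank T] `<=` M ->
  M `<=` [set T | representable T] ->
  (forall (A : set Omega) (mA : measurable A) (T : L1 s mu -> L1 s mu),
     M T -> M (restrict_op mA T)) ->
  BPBp_nu_with M eta.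
Proof.
exists (fun eps => (eps / 8) ^+ 3 / 4); split.
  by move=> eps /andP[eps0 _]; rewrite divr_gt0// exprn_gt0// divr_gt0.
by move=> d Omega mu M; exact: exists_near_attaining.
Qed.
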